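(* Let $m\ge 2$ be an integer, let $\alpha\in\mathbb{C}$, let $\alpha_1,\dots,\alpha_{m-1}$ be different complex parameters, and let $\lambda\in\mathbb{C}^\times$ be such that the $\mu$-functions below are defined, i.e. $\lambda q^{\alpha_j}\notin q^{\mathbb{Z}}$ for all $j$. Then the $q$-difference equation $$\left[\prod_{k=1}^{m-1}(T_x-q^{\alpha_k})\right](T_x+xq^{\alpha})f(x)=0$$ has the following fundamental solutions: $$\frac{1}{\theta_q(-xq^{\alpha})},\qquad x^{\alpha+\alpha_j-\frac12}\,\mu(x\lambda q^{\alpha},\lambda q^{\alpha_j};q)\quad (j=1,\dots,m-1).$$
   Context: Throughout $q\in\mathbb{C}^\times$ with $|q|<1$. Fix a logarithm $\log q$ and put $q^c=\exp(c\log q)$ for $c\in\mathbb{C}$. Functions of $x$ are meromorphic functions of $\log x$ (i.e. on the universal cover of $\mathbb{C}^\times$), with $x^c=\exp(c\log x)$; fix also $\log\lambda$. $T_x$ is the $q$-shift $T_xf(x)=f(xq)$ (i.e. $\log x\mapsto \log x+\log q$). Jacobi's theta function is $$\theta_q(x)=\sum_{n\in\mathbb{Z}}x^nq^{\frac{n(n-1)}{2}}.$$ Zwegers' $\mu$-function is, for $x,y\notin q^{\mathbb{Z}}$, $$\mu(x,y;q)=iq^{-\frac18}\frac{\sqrt{xy}}{\theta_q(-y)}\sum_{n\in\mathbb{Z}}\frac{(-1)^ny^nq^{\frac{n(n+1)}{2}}}{1-xq^n},\qquad \sqrt{xy}=\exp\left(\tfrac12(\log x+\log y)\right),$$ where the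 logarithm of a product such as $x\lambda q^{\alpha}$ is taken as $\log x+\log\lambda+\alpha\log q$. ''Fundamental solutions'' of a linear $q$-difference equation of order $m$ means: $m$ solutions that are linearly independent over the field of $q$-periodic functions (functions $c$ with $T_xc=c$), so that every solution is a linear combination of them with $q$-periodic coefficients.
   Formalization: Two corrections: the exponent of x is α_j−1/2 instead of α+α_j−1/2 (as printed, the functions are not solutions unless q^α=1), and ''different'' parameters means q^{α_1},…,q^{α_{m-1}} pairwise different (otherwise two solutions are dependent over q-periodic functions). *)

(* Defs.v *)
From Stdlib Require Import Reals ZArith.
From Coquelicot Require Import Coquelicot.

Open Scope C_scope.

Definition Cexp (z : C) : C :=
  (RtoC (exp (Re z)) * (RtoC (cos (Im z)) + Ci * RtoC (sin (Im z))))%C.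

Definition Cpowz (x : C) (n : Z) : C :=
  match n with
  | Z0 => RtoC 1
  | Zpos p => x ^ Pos.to_nat p
  | Zneg p => / (x ^ Pos.to_nat p)
  end.

Definition CSeries (a : nat -> C) : C :=
  (Series (fun n => Re (a n)), Series (fun n => Im (a n))).

Definition CSeriesZ (a : Z -> C) : C :=
  CSeries (fun n => a (Z.of_nat n)) +
  CSeries (fun n => a (- Z.of_nat (S n))%Z).

Definition theta (q x : C) : C :=
  CSeriesZ (fun n => Cpowz x n * Cpowz q (n * (n - 1) / 2)).

(* The function mu(x,y;q) of the logarithms of q, x and y, on which q^(-1/8)
   and sqrt(xy) depend. *)
Definition mu (logq logx logy : C) : C :=
  let q := Cexp logq in let x := Cexp logx in let y := Cexp logy in
  Ci * Cexp (- (logq / RtoC 8)) *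
  (Cexp ((logx + logy) / RtoC 2) / theta q (- y)) *
  CSeriesZ (fun n =>
    Cpowz (- RtoC 1) n * Cpowz y n * Cpowz q (n * (n + 1) / 2)
    / (RtoC 1 - x * Cpowz q n)).

(* A meromorphic function is represented by a total function C -> C whose
   values on a closed discrete set are irrelevant: [mero_eq] is equality of
   meromorphic functions. *)
Definition mero_eq (f g : C -> C) : Prop :=
  forall z0 : C, locally' z0 (fun z => f z = g z).

Definition holomorphic_near (g : C -> C) (z0 : C) : Prop :=
  locally z0 (fun z => @ex_derive C_AbsRing C_NormedModule g z).

Definition meromorphic (f : C -> C) : Prop :=
  forall z0 : C, exists (n : nat) (g : C -> C),
    holomorphic_near g z0 /\
    locally' z0 (fun z => (z - z0) ^ n * f z = g z).

(* Functions of x are functions of u = log x, so T_x is u |-> u + log q. *)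
Definition qshift (logq : C) (f : C -> C) : C -> C := fun u => f (u + logq).

Definition qperiodic (logq : C) (c : C -> C) : Prop :=
  meromorphic c /\ mero_eq (qshift logq c) c.

Definition solution (P : (C -> C) -> (C -> C)) (f : C -> C) : Prop :=
  meromorphic f /\ mero_eq (P f) (fun _ => RtoC 0).

Definition lincomb (m : nat) (c f : nat -> C -> C) : C -> C :=
  fun u => sum_n (fun j => c j u * f j u) (m - 1).

(* f 0, ..., f (m-1), for m >= 1. *)
Definition fundamental_solutions (logq : C) (m : nat)
    (P : (C -> C) -> (C -> C)) (f : nat -> C -> C) : Prop :=
  (forall j, (j < m)%nat -> solution P (f j)) /\
  (forall c : nat -> C -> C,
     (forall j, (j < m)%nat -> qperiodic logq (c j)) ->
     mero_eq (lincomb m c f) (fun _ => RtoC 0) ->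
     forall j, (j < m)%nat -> mero_eq (c j) (fun _ => RtoC 0)) /\
  (forall g : C -> C, solution P g ->
     exists c : nat -> C -> C,
       (forall j, (j < m)%nat -> qperiodic logq (c j)) /\
       mero_eq g (lincomb m c f)).

(* (T_x - q^(a 1)) (T_x - q^(a 2)) ... (T_x - q^(a n)), rightmost factor
   applied first. *)
Fixpoint qprod (logq : C) (a : nat -> C) (n : nat) (f : C -> C) : C -> C :=
  match n with
  | O => f
  | S k => qprod logq a k
             (fun u => qshift logq f u - Cexp (a (S k) * logq) * f u)
  end.

Definition qdiff_op (logq alpha : C) (a : nat -> C) (m : nat)
    (f : C -> C) : C -> C :=
  qprod logq a (m - 1)
    (fun u => qshift logq f u + Cexp u * Cexp (alpha * logq) * f u).

(* Index 0 is 1/theta_q(-x q^alpha); index j >= 1 is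
   x^(a_j - 1/2) mu(x lambda q^alpha, lambda q^(a_j); q).
   Pitfall: the exponent is a_j - 1/2, not alpha + a_j - 1/2 as printed in the
   source.  From
     mu(xq,y) = - q^(1/2) (x/y) mu(x,y) - i q^(3/8) (x/y)^(1/2)
   a function f = x^c mu(x lambda q^alpha, lambda q^(a_j)) satisfies
     T_x f = - x q^(c + 1/2 + alpha - a_j) f + const x^(c + 1/2),
   so (T_x - q^(a_j)) (T_x + x q^alpha) f = 0 requires q^(c + 1/2) = q^(a_j). *)
Definition qsol (logq loglambda alpha : C) (a : nat -> C) (j : nat) : C -> C :=
  match j with
  | O => fun u => / theta (Cexp logq) (- (Cexp u * Cexp (alpha * logq)))
  | S _ => fun u =>
      Cexp ((a j - RtoC 1 / RtoC 2) * u) *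
      mu logq (u + loglambda + alpha * logq) (loglambda + a j * logq)
  end.

(* Main.v *)
Require Import Defs.
From Stdlib Require Import Reals ZArith Lia Lra.
From Coquelicot Require Import Coquelicot.

Open Scope C_scope.

(** The operator factors: [T + x q^alpha] kills [1/theta_q(-x q^alpha)] by the
    quasi-periodicity of theta, and sends the [mu]-solution of index [j] to a
    nonzero multiple of [x^(a j)], because [mu(xq, y)] and [mu(x, y)] differ by
    an elementary term.  The [x^(a j)] are eigenvectors of [T] with distinct
    eigenvalues, so they form a basis of the kernel of the product of the
    [T - q^(a k)] over the periodic functions; independence and spanning follow
    by induction on the number of factors.

    The analytic input is that [theta_q] vanishes only on [-q^Z], and there to
    finite order.  This comes from a lower bound of [theta_q] by finitely many
    factors of its product, obtained as the limit of the finite Jacobi triple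
    product with an explicit rate.  Power series, partial fraction series and
    reciprocals are differentiated through quadratic remainder bounds, so no
    Cauchy theory is needed. *)

(** * Complex derivatives *)

(** Spanning asks for meromorphic coefficients, so division is the obstacle: inverting an arbitrary
    nonzero meromorphic function would call for the identity theorem. The argument is arranged so
    that only theta, functions [1 - p e^u], exponentials and nonzero constants are ever inverted.
    For the first two, an explicit bound [c |u - u0|^n <= |f u|] near each point takes the place of
    the order of vanishing. The coefficient of the theta solution is recovered by multiplying with
    theta, which is entire in [u]; the other coefficients only need differences of eigenvalues,
    exponentials and the constants [K j].

    For the bound on theta, fix an annulus: all but finitely many factors are there within [1/2] of
    1, at a geometric rate, so their product is bounded below uniformly in its length. The finitely
    many others have elementary zeros in the variable [u].

    Values at poles are irrelevant, hence functional equations are checked on deleted neighbourhoods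
    where all denominators are nonzero. For the Appell series these are infinitely many conditions,
    of which only finitely many can fail near a given point. *)

Lemma locally_Cmod (z0 : C) (P : C -> Prop) :
  locally z0 P <->
  exists d : R, (0 < d)%R /\ forall z, (Cmod (z - z0) < d)%R -> P z.
Proof.
  split.
  - intros [d Hd]. exists d. split; [apply cond_pos|].
    intros z Hz. apply Hd. apply C_NormedModule_mixin_compat1. exact Hz.
  - intros [d [Hd H]].
    (* The balls of [C] are the squares of R x R; the disc of radius [d] contains the square of
       half-side [d / sqrt 2]. *)
    assert (Hs : (0 < sqrt 2)%R) by (apply sqrt_lt_R0; lra).
    exists (mkposreal (d / sqrt 2)%R (Rdiv_lt_0_compat _ _ Hd Hs)).
    intros z Hz. apply H.
    apply C_NormedModule_mixin_compat2 in Hz. simpl in Hz.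
    replace d with (sqrt 2 * (d / sqrt 2))%R by (field; lra). exact Hz.
Qed.

Lemma locally_locally' (z0 : C) (P : C -> Prop) : locally z0 P -> locally' z0 P.
Proof. unfold locally', within. apply filter_imp. auto. Qed.

Definition Cderiv (f : C -> C) (z d : C) : Prop :=
  forall eps : R, (0 < eps)%R -> exists delta : R, (0 < delta)%R /\
    forall w, (Cmod (w - z) < delta)%R ->
      (Cmod (f w - f z - d * (w - z)) <= eps * Cmod (w - z))%R.

Definition Cdiff (f : C -> C) (z : C) : Prop :=
  @ex_derive C_AbsRing C_NormedModule f z.

Lemma Cderiv_is_derive (f : C -> C) (z d : C) :
  Cderiv f z d <-> @is_derive C_AbsRing C_NormedModule f z d.
Proof.
  split.
  - intros H. split; [apply is_linear_scal_l|].
    intros x Hx.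
    apply (@is_filter_lim_locally_unique C_AbsRing (AbsRing_NormedModule C_AbsRing)) in Hx.
    change (z = x) in Hx. subst x.
    intros [eps Heps]. destruct (H eps Heps) as [delta [Hd Hw]].
    exists (mkposreal delta Hd). intros w Hbw.
    change (Cmod (f w - f z - (w - z) * d) <= eps * Cmod (w - z))%R.
    rewrite (Cmult_comm (w - z) d). apply Hw. exact Hbw.
  - intros [_ H] eps Heps.
    destruct (H z (fun P HP => HP) (mkposreal eps Heps)) as [delta Hw].
    exists delta. split; [apply cond_pos|]. intros w Hbw.
    specialize (Hw w Hbw).
    change (Cmod (f w - f z - (w - z) * d) <= eps * Cmod (w - z))%R in Hw.
    rewrite (Cmult_comm (w - z) d) in Hw. exact Hw.
Qed.

(* [C_NormedModule] and [AbsRing_NormedModule C_AbsRing] are not convertible; the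
   product and chain rules of Coquelicot are stated with the latter. *)
Lemma Cderiv_is_derive_ring (f : C -> C) (z d : C) :
  Cderiv f z d <-> @is_derive C_AbsRing (AbsRing_NormedModule C_AbsRing) f z d.
Proof.
  split.
  - intros H. split; [apply is_linear_scal_l|].
    intros x Hx.
    apply (@is_filter_lim_locally_unique C_AbsRing (AbsRing_NormedModule C_AbsRing)) in Hx.
    change (z = x) in Hx. subst x.
    intros [eps Heps]. destruct (H eps Heps) as [delta [Hd Hw]].
    exists (mkposreal delta Hd). intros w Hbw.
    change (Cmod (f w - f z - (w - z) * d) <= eps * Cmod (w - z))%R.
    rewrite (Cmult_comm (w - z) d). apply Hw. exact Hbw.
  - intros [_ H] eps Heps.
    destruct (H z (fun P HP => HP) (mkposreal eps Heps)) as [delta Hw].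
    exists delta. split; [apply cond_pos|]. intros w Hbw.
    specialize (Hw w Hbw).
    change (Cmod (f w - f z - (w - z) * d) <= eps * Cmod (w - z))%R in Hw.
    rewrite (Cmult_comm (w - z) d) in Hw. exact Hw.
Qed.

Lemma Cderiv_Cdiff (f : C -> C) (z d : C) : Cderiv f z d -> Cdiff f z.
Proof. intros H. exists d. now apply Cderiv_is_derive. Qed.

(** A remainder [O(|w - z|^2)] is [o(|w - z|)]; dividing by [|M| + 1] keeps the radius positive
    whatever the sign of [M]. All concrete derivatives below are obtained through this criterion. *)
Lemma Cderiv_quadratic (f : C -> C) (z d : C) (M r : R) :
  (0 < r)%R ->
  (forall w, (Cmod (w - z) < r)%R ->
     (Cmod (f w - f z - d * (w - z)) <= M * Cmod (w - z) ^ 2)%R) ->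
  Cderiv f z d.
Proof.
  intros Hr H eps Heps.
  assert (HM : (0 < Rabs M + 1)%R) by (pose proof (Rabs_pos M); lra).
  exists (Rmin r (eps / (Rabs M + 1))%R). split.
  - apply Rmin_pos; [easy|]. now apply Rdiv_lt_0_compat.
  - intros w Hw.
    assert (H1 : (Cmod (w - z) < r)%R) by (eapply Rlt_le_trans; [apply Hw|apply Rmin_l]).
    assert (H2 : (Cmod (w - z) < eps / (Rabs M + 1))%R)
      by (eapply Rlt_le_trans; [apply Hw|apply Rmin_r]).
    eapply Rle_trans; [apply H, H1|].
    pose proof (Cmod_ge_0 (w - z)). pose proof (Rle_abs M).
    apply Rlt_div_r in H2; [|lra].
    simpl. rewrite Rmult_1_r, <- Rmult_assoc.
    apply Rmult_le_compat_r; [easy|]. nra.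
Qed.

Lemma Cdiff_const (c z : C) : Cdiff (fun _ => c) z.
Proof. apply ex_derive_const. Qed.

Lemma Cdiff_id (z : C) : Cdiff (fun w => w) z.
Proof.
  apply (Cderiv_Cdiff _ _ (RtoC 1)), Cderiv_is_derive_ring. exact (is_derive_id z).
Qed.

Lemma Cdiff_plus (f g : C -> C) (z : C) :
  Cdiff f z -> Cdiff g z -> Cdiff (fun w => f w + g w) z.
Proof.
  intros [d Hd] [e He]. exists (d + e).
  exact (@is_derive_plus C_AbsRing C_NormedModule f g z d e Hd He).
Qed.

Lemma Cdiff_mult (f g : C -> C) (z : C) :
  Cdiff f z -> Cdiff g z -> Cdiff (fun w => f w * g w) z.
Proof.
  intros [d Hd] [e He].
  apply Cderiv_is_derive, Cderiv_is_derive_ring in Hd, He.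
  apply (Cderiv_Cdiff _ _ (d * g z + f z * e)), Cderiv_is_derive_ring.
  exact (@is_derive_mult C_AbsRing f g z d e Hd He Cmult_comm).
Qed.

Lemma Cdiff_opp (f : C -> C) (z : C) : Cdiff f z -> Cdiff (fun w => - f w) z.
Proof.
  intros [d Hd]. exists (- d).
  exact (@is_derive_opp C_AbsRing C_NormedModule f z d Hd).
Qed.

Lemma Cdiff_minus (f g : C -> C) (z : C) :
  Cdiff f z -> Cdiff g z -> Cdiff (fun w => f w - g w) z.
Proof. intros Hf Hg. apply Cdiff_plus; [easy|]. now apply Cdiff_opp. Qed.

Lemma Cdiff_comp (f g : C -> C) (z : C) :
  Cdiff f (g z) -> Cdiff g z -> Cdiff (fun w => f (g w)) z.
Proof.
  intros [d Hd] [e He]. exists (e * d).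
  apply Cderiv_is_derive, Cderiv_is_derive_ring in He.
  exact (@is_derive_comp C_AbsRing C_NormedModule f g z d e Hd He).
Qed.

Lemma Cdiff_pow (f : C -> C) (n : nat) (z : C) :
  Cdiff f z -> Cdiff (fun w => f w ^ n) z.
Proof.
  intros Hf. induction n as [|n IH]; simpl.
  - apply Cdiff_const.
  - now apply Cdiff_mult.
Qed.

Lemma Cdiff_ext_near (f g : C -> C) (z : C) :
  locally z (fun w => f w = g w) -> Cdiff f z -> Cdiff g z.
Proof.
  rewrite locally_Cmod. intros [r [Hr H]] [d Hd].
  apply Cderiv_is_derive in Hd.
  apply (Cderiv_Cdiff _ _ d). intros eps Heps.
  destruct (Hd eps Heps) as [delta [Hdl Hw]].
  exists (Rmin delta r). split; [now apply Rmin_pos|].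
  intros w Hww.
  rewrite <- (H w), <- (H z).
  - apply Hw. eapply Rlt_le_trans; [apply Hww|apply Rmin_l].
  - replace (z - z) with (RtoC 0) by ring. now rewrite Cmod_0.
  - eapply Rlt_le_trans; [apply Hww|apply Rmin_r].
Qed.

Lemma Cmod_minus_sym (a b : C) : Cmod (a - b) = Cmod (b - a).
Proof. rewrite <- Cmod_opp. f_equal. ring. Qed.

Lemma Cmod_triangle_inv (a b : C) : (Cmod a - Cmod b <= Cmod (a - b))%R.
Proof.
  pose proof (Cmod_triangle (a - b) b) as H.
  replace (a - b + b) with a in H by ring. lra.
Qed.

(** The remainder is exactly [(w - z)^2 / (w z^2)], and [|w| >= |z|/2] on the disc of radius [|z|/2]
    gives the constant [2 / |z|^3]. *)
Lemma Cdiff_inv (z : C) : z <> 0 -> Cdiff Cinv z.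
Proof.
  intros Hz. apply (Cderiv_Cdiff _ _ (- / (z * z))).
  assert (Hm : (0 < Cmod z)%R) by now apply Cmod_gt_0.
  apply (Cderiv_quadratic _ _ _ (2 / Cmod z ^ 3) (Cmod z / 2)); [lra|].
  intros w Hw.
  assert (Hw2 : (Cmod z / 2 <= Cmod w)%R).
  { pose proof (Cmod_triangle_inv z w). rewrite (Cmod_minus_sym z w) in H. lra. }
  assert (Hw0 : w <> 0) by (apply Cmod_gt_0; lra).
  replace (/ w - / z - - / (z * z) * (w - z)) with ((w - z) * (w - z) / (w * (z * z)))
    by (field; auto).
  rewrite Cmod_div by (repeat apply Cmult_neq_0; auto).
  rewrite !Cmod_mult.
  unfold Rdiv. rewrite Rmult_comm. simpl. rewrite !Rmult_1_r.
  apply Rmult_le_compat_r.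
  { apply Rmult_le_pos; apply Cmod_ge_0. }
  replace (2 * / (Cmod z * (Cmod z * Cmod z)))%R
    with (/ ((Cmod z / 2) * (Cmod z * Cmod z)))%R by (field; lra).
  apply Rinv_le_contravar.
  - repeat apply Rmult_lt_0_compat; lra.
  - apply Rmult_le_compat_r; [apply Rmult_le_pos; lra|lra].
Qed.

Lemma Cdiff_Cinv (f : C -> C) (z : C) :
  Cdiff f z -> f z <> 0 -> Cdiff (fun w => / f w) z.
Proof. intros Hf Hz. apply (Cdiff_comp Cinv f); [now apply Cdiff_inv|easy]. Qed.

(** * The complex exponential and meromorphic functions *)

Lemma Cdiff_near (f : C -> C) (z : C) (eps : R) :
  Cdiff f z -> (0 < eps)%R -> locally z (fun w => (Cmod (f w - f z) < eps)%R).
Proof.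
  intros [d Hd] Heps. apply Cderiv_is_derive in Hd.
  destruct (Hd 1%R Rlt_0_1) as [r [Hr H]].
  assert (Hp : (0 < Cmod d + 1)%R) by (pose proof (Cmod_ge_0 d); lra).
  apply locally_Cmod. exists (Rmin r (eps / (Cmod d + 1))). split.
  - apply Rmin_pos; [easy|]. now apply Rdiv_lt_0_compat.
  - intros w Hw.
    assert (H1 : (Cmod (w - z) < r)%R) by (eapply Rlt_le_trans; [apply Hw|apply Rmin_l]).
    assert (H2 : (Cmod (w - z) < eps / (Cmod d + 1))%R)
      by (eapply Rlt_le_trans; [apply Hw|apply Rmin_r]).
    apply Rlt_div_r in H2; [|lra].
    specialize (H w H1).
    replace (f w - f z) with ((f w - f z - d * (w - z)) + d * (w - z)) by ring.
    eapply Rle_lt_trans; [apply Cmod_triangle|]. rewrite Cmod_mult. lra.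
Qed.

Lemma Cmod_le_abs (a b : R) : (Cmod (a, b) <= Rabs a + Rabs b)%R.
Proof.
  replace (a, b) with (RtoC a + Ci * RtoC b).
  - eapply Rle_trans; [apply Cmod_triangle|].
    rewrite Cmod_mult, Cmod_Ci, !Cmod_R. lra.
  - unfold RtoC, Ci, Cplus, Cmult; simpl. f_equal; ring.
Qed.

Lemma Im_le_Cmod (z : C) : (Rabs (Im z) <= Cmod z)%R.
Proof. eapply Rle_trans; [|apply Rmax_Cmod]. apply Rmax_r. Qed.

Lemma Cexp_pair (z : C) :
  Cexp z = ((exp (Re z) * cos (Im z))%R, (exp (Re z) * sin (Im z))%R).
Proof. unfold Cexp, RtoC, Ci, Cplus, Cmult; simpl. f_equal; ring. Qed.

Lemma Cexp_plus (z w : C) : Cexp (z + w) = Cexp z * Cexp w.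
Proof.
  rewrite !Cexp_pair. destruct z as [a b], w as [c d].
  unfold Cplus, Cmult; simpl.
  rewrite exp_plus, cos_plus, sin_plus. f_equal; ring.
Qed.

Lemma Cexp_0 : Cexp 0 = 1.
Proof.
  rewrite Cexp_pair. simpl. rewrite exp_0, cos_0, sin_0.
  unfold RtoC. f_equal; ring.
Qed.

Lemma Cmod_Cexp (z : C) : Cmod (Cexp z) = exp (Re z).
Proof.
  rewrite Cexp_pair. unfold Cmod; simpl.
  replace (exp (Re z) * cos (Im z) * (exp (Re z) * cos (Im z) * 1) +
           exp (Re z) * sin (Im z) * (exp (Re z) * sin (Im z) * 1))%R
    with ((exp (Re z) * exp (Re z)) * (Rsqr (sin (Im z)) + Rsqr (cos (Im z))))%R
    by (unfold Rsqr; ring).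
  rewrite sin2_cos2, Rmult_1_r. apply sqrt_square. left. apply exp_pos.
Qed.

Lemma Cexp_neq_0 (z : C) : Cexp z <> 0.
Proof. apply Cmod_gt_0. rewrite Cmod_Cexp. apply exp_pos. Qed.

Lemma Cexp_opp (z : C) : Cexp (- z) = / Cexp z.
Proof.
  pose proof (Cexp_neq_0 z).
  replace (Cexp (- z)) with (Cexp (- z) * Cexp z / Cexp z) by (field; auto).
  rewrite <- Cexp_plus. replace (- z + z) with (RtoC 0) by ring.
  rewrite Cexp_0. field; auto.
Qed.

(** From [exp (-a) >= 1 - a] one gets [exp a <= 1 / (1 - a)], and [(1 + a + 2a^2)(1 - a) = 1 + a^2
    (1 - 2a) >= 1] for [a <= 1/2]. *)
Lemma Rabs_exp_sub1_le (a : R) :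
  (Rabs a <= 1 / 2)%R -> (Rabs (exp a - 1 - a) <= 2 * a ^ 2)%R.
Proof.
  intros Ha. apply Rabs_le_between in Ha.
  assert (H1 : (1 + a <= exp a)%R) by (apply exp_ineq1_le).
  assert (H2 : (1 - a <= exp (- a))%R) by (pose proof (exp_ineq1_le (- a)); lra).
  pose proof (exp_pos a) as Hp.
  assert (H3 : (exp a * (1 - a) <= 1)%R).
  { rewrite exp_Ropp in H2.
    apply Rmult_le_compat_l with (r := exp a) in H2; [|lra].
    rewrite Rinv_r in H2; lra. }
  rewrite Rabs_pos_eq by lra.
  assert (H4 : ((1 + a + 2 * a ^ 2 - exp a) * (1 - a) >= 0)%R).
  { assert (0 <= a ^ 2 * (1 - 2 * a))%R by (apply Rmult_le_pos; nra). nra. }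
  nra.
Qed.

Lemma Rabs_sin_le (b : R) : (Rabs (sin b) <= Rabs b)%R.
Proof.
  destruct (MVT_gen sin 0 b cos) as [c [_ Hc]].
  - intros x _. auto_derive; [easy|ring].
  - intros x _. apply continuity_sin.
  - rewrite sin_0, !Rminus_0_r in Hc. rewrite Hc, Rabs_mult.
    pose proof (Rabs_pos b). pose proof (COS_bound c).
    assert (Rabs (cos c) <= 1)%R by (apply Rabs_le; lra). nra.
Qed.

Lemma Rabs_cos_sub1_le (b : R) : (Rabs (cos b - 1) <= b ^ 2)%R.
Proof.
  replace b with (2 * (b / 2))%R at 1 by field. rewrite cos_2a_sin.
  replace (1 - 2 * sin (b / 2) * sin (b / 2) - 1)%R
    with (- (2 * (sin (b / 2)) ^ 2))%R by ring.
  rewrite Rabs_Ropp, Rabs_pos_eq by (pose proof (pow2_ge_0 (sin (b / 2))); lra).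
  pose proof (Rabs_sin_le (b / 2)) as H. apply Rsqr_le_abs_1 in H.
  unfold Rsqr in H. simpl. nra.
Qed.

Lemma Rabs_sin_sub_le (b : R) : (Rabs b <= 1 -> Rabs (sin b - b) <= b ^ 2)%R.
Proof.
  intros Hb.
  destruct (MVT_gen (fun x => sin x - x)%R 0 b (fun x => cos x - 1)%R) as [c [Hc1 Hc]].
  - intros x _. auto_derive; [easy|ring].
  - intros x _. apply continuity_pt_minus; [apply continuity_sin|apply continuity_pt_id].
  - rewrite sin_0, !Rminus_0_r in Hc. rewrite Hc, Rabs_mult.
    pose proof (Rabs_cos_sub1_le c) as H. pose proof (Rabs_pos b).
    assert (Rabs c <= Rabs b)%R.
    { unfold Rmin, Rmax in Hc1. destruct (Rle_dec 0 b).
      - rewrite !Rabs_pos_eq; lra.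
      - rewrite !Rabs_left1; lra. }
    rewrite <- pow2_abs in H. rewrite <- (pow2_abs b).
    pose proof (Rabs_pos c). pose proof (Rabs_pos (cos c - 1)).
    assert (Rabs c ^ 2 <= Rabs b)%R by nra. simpl in *. nra.
Qed.

(** The real and the imaginary part are each rewritten through the remainders of [exp], [cos] and
    [sin]; each costs at most [4 r^2], hence the constant 8. *)
Lemma Cmod_Cexp_sub1_le (w : C) :
  (Cmod w <= 1 / 2)%R -> (Cmod (Cexp w - 1 - w) <= 8 * Cmod w ^ 2)%R.
Proof.
  intros Hw. rewrite Cexp_pair.
  pose proof (re_le_Cmod w) as Ha. pose proof (Im_le_Cmod w) as Hb.
  set (r := Cmod w) in *.
  replace ((exp (Re w) * cos (Im w))%R, (exp (Re w) * sin (Im w))%R)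
    with (RtoC (exp (Re w) * cos (Im w)) + Ci * RtoC (exp (Re w) * sin (Im w)))
    by (unfold RtoC, Ci, Cplus, Cmult; simpl; f_equal; ring).
  destruct w as [a b]; simpl in *.
  replace (_ - 1 - _) with ((exp a * cos b - 1 - a)%R, (exp a * sin b - b)%R)
    by (unfold RtoC, Ci, Cplus, Cmult, Cminus, Copp, Cplus; simpl; f_equal; ring).
  eapply Rle_trans; [apply Cmod_le_abs|].
  pose proof (Rabs_exp_sub1_le a ltac:(lra)) as He.
  pose proof (Rabs_cos_sub1_le b) as Hc.
  pose proof (Rabs_sin_le b) as Hs.
  pose proof (Rabs_sin_sub_le b ltac:(lra)) as Hs'.
  rewrite <- (pow2_abs a) in He. rewrite <- (pow2_abs b) in Hc, Hs'.
  pose proof (Rabs_pos a). pose proof (Rabs_pos b).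
  assert (Hcb : (Rabs (cos b) <= 1)%R)
    by (pose proof (COS_bound b); apply Rabs_le; lra).
  assert (Ha2 : (Rabs a ^ 2 <= r ^ 2)%R) by (apply pow_incr; lra).
  assert (Hb2 : (Rabs b ^ 2 <= r ^ 2)%R) by (apply pow_incr; lra).
  assert (Hr : (Rabs (exp a * cos b - 1 - a) <= 4 * r ^ 2)%R).
  { replace (exp a * cos b - 1 - a)%R
      with ((exp a - 1 - a) * cos b + (1 + a) * (cos b - 1))%R by ring.
    eapply Rle_trans; [apply Rabs_triang|]. rewrite !Rabs_mult.
    assert (Rabs (1 + a) <= 2)%R.
    { eapply Rle_trans; [apply Rabs_triang|]. rewrite Rabs_R1. lra. }
    pose proof (Rabs_pos (exp a - 1 - a)). pose proof (Rabs_pos (cos b - 1)).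
    nra. }
  assert (Hi : (Rabs (exp a * sin b - b) <= 4 * r ^ 2)%R).
  { replace (exp a * sin b - b)%R
      with ((exp a - 1 - a) * sin b + a * sin b + (sin b - b))%R by ring.
    eapply Rle_trans; [apply Rabs_triang|].
    assert (Rabs ((exp a - 1 - a) * sin b + a * sin b) <= 3 * r ^ 2)%R; [|lra].
    eapply Rle_trans; [apply Rabs_triang|]. rewrite !Rabs_mult.
    pose proof (Rabs_pos (exp a - 1 - a)). pose proof (Rabs_pos (sin b)).
    assert (Rabs a * Rabs (sin b) <= r ^ 2)%R by (simpl; nra).
    assert (Rabs (exp a - 1 - a) * Rabs (sin b) <= 2 * r ^ 2)%R by nra.
    lra. }
  lra.
Qed.

Lemma Cdiff_Cexp (z : C) : Cdiff Cexp z.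
Proof.
  apply (Cderiv_Cdiff _ _ (Cexp z)).
  apply (Cderiv_quadratic _ _ _ (Cmod (Cexp z) * 8) (1 / 2)); [lra|].
  intros w Hw.
  replace (Cexp w) with (Cexp z * Cexp (w - z))
    by (rewrite <- Cexp_plus; f_equal; ring).
  replace (Cexp z * Cexp (w - z) - Cexp z - Cexp z * (w - z))
    with (Cexp z * (Cexp (w - z) - 1 - (w - z))) by ring.
  rewrite Cmod_mult, Rmult_assoc.
  apply Rmult_le_compat_l; [apply Cmod_ge_0|].
  apply Cmod_Cexp_sub1_le. lra.
Qed.

(* At a zero [1 - p e^u = 1 - e^(u - u0)] has a simple zero; elsewhere the bound is continuity. *)
Lemma one_minus_Cexp_lower (p u0 : C) :
  exists c : R, (0 < c)%R /\
    locally u0 (fun u => (c * Cmod (u - u0) <= Cmod (1 - p * Cexp u))%R).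
Proof.
  destruct (Ceq_dec (1 - p * Cexp u0) 0) as [H0|H0].
  (* For [|h| < 1/16] the quadratic error [8 |h|^2] is at most [|h|/2], so half of the linear term
     survives. *)
  - exists (1 / 2)%R. split; [lra|]. apply locally_Cmod. exists (1 / 16)%R.
    split; [lra|]. intros u Hu.
    assert (He : p * Cexp u = Cexp (u - u0)).
    { replace u with (u0 + (u - u0)) at 1 by ring. rewrite Cexp_plus.
      replace (p * (Cexp u0 * Cexp (u - u0)))
        with ((1 - (1 - p * Cexp u0)) * Cexp (u - u0)) by ring.
      rewrite H0. ring. }
    rewrite He.
    pose proof (Cmod_Cexp_sub1_le (u - u0) ltac:(lra)) as Hq.
    pose proof (Cmod_triangle_inv (u - u0) (- (Cexp (u - u0) - 1 - (u - u0)))) as Ht.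
    rewrite Cmod_opp in Ht.
    replace (u - u0 - - (Cexp (u - u0) - 1 - (u - u0)))
      with (- (1 - Cexp (u - u0))) in Ht by ring.
    rewrite Cmod_opp in Ht. pose proof (Cmod_ge_0 (u - u0)). nra.
  - assert (Hm : (0 < Cmod (1 - p * Cexp u0))%R) by now apply Cmod_gt_0.
    set (m := Cmod (1 - p * Cexp u0)) in *.
    exists (m / 2)%R. split; [lra|].
    assert (Hd : Cdiff (fun u => 1 - p * Cexp u) u0).
    { apply Cdiff_minus; [apply Cdiff_const|].
      apply Cdiff_mult; [apply Cdiff_const|apply Cdiff_Cexp]. }
    assert (Hn := Cdiff_near _ _ (m / 2) Hd ltac:(lra)).
    apply locally_Cmod in Hn. destruct Hn as [r [Hr Hn]].
    apply locally_Cmod. exists (Rmin r 1). split; [apply Rmin_pos; lra|].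
    intros u Hu. specialize (Hn u (Rlt_le_trans _ _ _ Hu (Rmin_l _ _))).
    pose proof (Rlt_le_trans _ _ _ Hu (Rmin_r _ _)) as Hu1.
    rewrite Cmod_minus_sym in Hn.
    pose proof (Cmod_triangle_inv (1 - p * Cexp u0) (1 - p * Cexp u)) as Ht.
    fold m in Ht. pose proof (Cmod_ge_0 (u - u0)). nra.
Qed.

(** * Closure properties of meromorphic functions, one point at a time *)

Definition meromorphic_at (f : C -> C) (z0 : C) : Prop :=
  exists (n : nat) (g : C -> C),
    holomorphic_near g z0 /\ locally' z0 (fun z => (z - z0) ^ n * f z = g z).

Lemma meromorphic_at_holomorphic (f : C -> C) (z0 : C) :
  holomorphic_near f z0 -> meromorphic_at f z0.
Proof.
  intros H. exists 0%nat, f. split; [easy|].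
  apply locally_locally'. apply filter_forall. intros z. simpl. ring.
Qed.

Lemma meromorphic_entire (f : C -> C) : (forall z, Cdiff f z) -> meromorphic f.
Proof.
  intros H z0. apply meromorphic_at_holomorphic.
  unfold holomorphic_near. apply filter_forall. exact H.
Qed.

Lemma meromorphic_at_ext (f g : C -> C) (z0 : C) :
  locally' z0 (fun z => f z = g z) -> meromorphic_at f z0 -> meromorphic_at g z0.
Proof.
  intros He [n [h [Hh H]]]. exists n, h. split; [easy|].
  generalize (filter_and _ _ He H). apply filter_imp.
  intros z [H1 H2]. now rewrite <- H1.
Qed.

Lemma meromorphic_ext (f g : C -> C) :
  mero_eq f g -> meromorphic f -> meromorphic g.
Proof. intros He Hf z0. exact (meromorphic_at_ext f g z0 (He z0) (Hf z0)). Qed.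

Lemma Cdiff_sub_pow (z0 : C) (n : nat) (z : C) : Cdiff (fun z => (z - z0) ^ n) z.
Proof.
  apply Cdiff_pow, Cdiff_minus; [apply Cdiff_id|apply Cdiff_const].
Qed.

Lemma meromorphic_at_mult (f g : C -> C) (z0 : C) :
  meromorphic_at f z0 -> meromorphic_at g z0 ->
  meromorphic_at (fun z => f z * g z) z0.
Proof.
  intros [n [f' [Hf Ef]]] [k [g' [Hg Eg]]].
  exists (n + k)%nat, (fun z => f' z * g' z). split.
  - unfold holomorphic_near in *.
    generalize (filter_and _ _ Hf Hg). apply filter_imp.
    intros z [H1 H2]. now apply Cdiff_mult.
  - generalize (filter_and _ _ Ef Eg). apply filter_imp.
    intros z [<- <-]. rewrite Cpow_add_r. ring.
Qed.

Lemma meromorphic_at_plus (f g : C -> C) (z0 : C) :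
  meromorphic_at f z0 -> meromorphic_at g z0 ->
  meromorphic_at (fun z => f z + g z) z0.
Proof.
  intros [n [f' [Hf Ef]]] [k [g' [Hg Eg]]].
  exists (n + k)%nat, (fun z => (z - z0) ^ k * f' z + (z - z0) ^ n * g' z). split.
  - unfold holomorphic_near in *.
    generalize (filter_and _ _ Hf Hg). apply filter_imp.
    intros z [H1 H2].
    apply Cdiff_plus; apply Cdiff_mult; try easy; apply Cdiff_sub_pow.
  - generalize (filter_and _ _ Ef Eg). apply filter_imp.
    intros z [<- <-]. rewrite Cpow_add_r. ring.
Qed.

Lemma meromorphic_mult (f g : C -> C) :
  meromorphic f -> meromorphic g -> meromorphic (fun z => f z * g z).
Proof. intros Hf Hg z0. exact (meromorphic_at_mult f g z0 (Hf z0) (Hg z0)). Qed.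

Lemma meromorphic_plus (f g : C -> C) :
  meromorphic f -> meromorphic g -> meromorphic (fun z => f z + g z).
Proof. intros Hf Hg z0. exact (meromorphic_at_plus f g z0 (Hf z0) (Hg z0)). Qed.

Lemma meromorphic_const (c : C) : meromorphic (fun _ => c).
Proof. apply meromorphic_entire. intros z. apply Cdiff_const. Qed.

Lemma locally_shift (z0 s : C) (P : C -> Prop) :
  locally (z0 + s) P -> locally z0 (fun z => P (z + s)).
Proof.
  rewrite !locally_Cmod. intros [d [Hd H]]. exists d. split; [easy|].
  intros z Hz. apply H. now replace (z + s - (z0 + s)) with (z - z0) by ring.
Qed.

Lemma locally'_shift (z0 s : C) (P : C -> Prop) :
  locally' (z0 + s) P -> locally' z0 (fun z => P (z + s)).
Proof.
  unfold locally', within.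
  intros H. apply locally_shift in H. revert H. apply filter_imp.
  intros z H Hz. apply H. intros E. apply Hz. change (@eq C z z0).
  replace z with (z + s - s) by ring. rewrite E. ring.
Qed.

Lemma meromorphic_shift (s : C) (f : C -> C) :
  meromorphic f -> meromorphic (fun z => f (z + s)).
Proof.
  intros Hf z0. destruct (Hf (z0 + s)) as [n [g [Hg E]]].
  exists n, (fun z => g (z + s)). split.
  - unfold holomorphic_near in *. apply locally_shift in Hg. revert Hg. apply filter_imp. intros z Hz.
    apply (Cdiff_comp g (fun z => z + s)); [exact Hz|].
    apply Cdiff_plus; [apply Cdiff_id|apply Cdiff_const].
  - apply locally'_shift in E. revert E. apply filter_imp. intros z E.
    rewrite <- E. f_equal. f_equal. ring.
Qed.

(* The exponent [n + 2] makes the quotient [O((z - z0)^2)], hence differentiable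
   at [z0] without any removable-singularity theorem. *)
Lemma meromorphic_at_inv (F : C -> C) (z0 : C) (n : nat) (c : R) :
  (0 < c)%R -> holomorphic_near F z0 ->
  locally z0 (fun z => (c * Cmod (z - z0) ^ n <= Cmod (F z))%R) ->
  meromorphic_at (fun z => / F z) z0.
Proof.
  intros Hc HF HL.
  set (g := fun z => (z - z0) ^ (n + 2) * / F z).
  assert (Hg0 : g z0 = 0).
  { unfold g. replace (z0 - z0) with (RtoC 0) by ring.
    rewrite Nat.add_comm. simpl. ring. }
  exists (n + 2)%nat, g. split.
  2:{ apply locally_locally'. apply filter_forall. intros z. reflexivity. }
  unfold holomorphic_near in *.
  pose proof (filter_and _ _ HF HL) as HA.
  apply locally_Cmod in HA. destruct HA as [r [Hr HA]].
  apply locally_Cmod. exists r. split; [easy|]. intros z Hz.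
  destruct (HA z Hz) as [HFz HLz].
  destruct (Ceq_dec z z0) as [->|Hne].
  - apply (Cderiv_Cdiff _ _ 0). apply (Cderiv_quadratic _ _ _ (/ c) r Hr).
    intros w Hw. rewrite Hg0.
    replace (g w - 0 - 0 * (w - z0)) with (g w) by ring.
    destruct (Ceq_dec w z0) as [->|Hw0].
    { rewrite Hg0, Cmod_0. apply Rmult_le_pos.
      - left. now apply Rinv_0_lt_compat.
      - apply pow_le, Cmod_ge_0. }
    destruct (HA w Hw) as [_ HLw].
    assert (Hp : (0 < Cmod (w - z0))%R).
    { apply Cmod_gt_0. intros E. apply Hw0. replace w with (w - z0 + z0) by ring.
      rewrite E. ring. }
    assert (Hpn := pow_lt _ n Hp).
    assert (Hcp : (0 < c * Cmod (w - z0) ^ n)%R) by now apply Rmult_lt_0_compat.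
    assert (HFw : F w <> 0) by (apply Cmod_gt_0; lra).
    unfold g. rewrite Cmod_mult, Cmod_inv, Cmod_pow, pow_add by easy.
    apply Rle_trans with
      (Cmod (w - z0) ^ n * Cmod (w - z0) ^ 2 * / (c * Cmod (w - z0) ^ n))%R.
    + apply Rmult_le_compat_l.
      * apply Rmult_le_pos; apply pow_le; lra.
      * apply Rinv_le_contravar; lra.
    + right. field. split; lra.
  - apply Cdiff_mult; [apply Cdiff_sub_pow|].
    apply Cdiff_Cinv; [exact HFz|].
    apply Cmod_gt_0. eapply Rlt_le_trans; [|apply HLz].
    apply Rmult_lt_0_compat; [easy|]. apply pow_lt, Cmod_gt_0.
    intros E. apply Hne. replace z with (z - z0 + z0) by ring. rewrite E. ring.
Qed.

(** * Equality of meromorphic functions and constant-coefficient operators *)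

Lemma mero_eq_refl (f : C -> C) : mero_eq f f.
Proof. intros z0. apply locally_locally'. now apply filter_forall. Qed.

Lemma mero_eq_ext (f g : C -> C) : (forall u, f u = g u) -> mero_eq f g.
Proof. intros H z0. apply locally_locally'. now apply filter_forall. Qed.

Lemma mero_eq_sym (f g : C -> C) : mero_eq f g -> mero_eq g f.
Proof. intros H z0. generalize (H z0). apply filter_imp. now intros z ->. Qed.

Lemma mero_eq_trans (f g h : C -> C) : mero_eq f g -> mero_eq g h -> mero_eq f h.
Proof.
  intros H1 H2 z0. generalize (filter_and _ _ (H1 z0) (H2 z0)).
  apply filter_imp. now intros z [-> ->].
Qed.

Lemma mero_eq_shift (s : C) (f g : C -> C) :
  mero_eq f g -> mero_eq (qshift s f) (qshift s g).
Proof.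
  intros H z0. generalize (locally'_shift z0 s _ (H (z0 + s))).
  apply filter_imp. now intros z.
Qed.

(** Reduces identities of meromorphic functions to algebra on values: the two deleted neighbourhoods
    are intersected, and at each point left the hypotheses are ordinary equations. *)
Lemma mero_eq_imp2 (f f' g g' h h' : C -> C) :
  (forall u, f u = f' u -> g u = g' u -> h u = h' u) ->
  mero_eq f f' -> mero_eq g g' -> mero_eq h h'.
Proof.
  intros H H1 H2 z0. generalize (filter_and _ _ (H1 z0) (H2 z0)).
  apply filter_imp. intros z [E1 E2]. now apply H.
Qed.

Lemma mero_eq_imp (f f' h h' : C -> C) :
  (forall u, f u = f' u -> h u = h' u) -> mero_eq f f' -> mero_eq h h'.
Proof.
  intros H H1. apply (mero_eq_imp2 f f' f f'); auto.
Qed.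

Lemma qprod_mero_eq (L : C) (a : nat -> C) (n : nat) (f g : C -> C) :
  mero_eq f g -> mero_eq (qprod L a n f) (qprod L a n g).
Proof.
  revert f g. induction n as [|n IH]; intros f g H; simpl; [easy|].
  apply IH. apply (mero_eq_imp2 (qshift L f) (qshift L g) f g).
  - now intros u -> ->.
  - now apply mero_eq_shift.
  - easy.
Qed.

Lemma qprod_ext (L : C) (a : nat -> C) (n : nat) (f g : C -> C) :
  (forall u, f u = g u) -> forall u, qprod L a n f u = qprod L a n g u.
Proof.
  revert f g. induction n as [|n IH]; intros f g H u; simpl; [apply H|].
  apply IH. intros v. unfold qshift. now rewrite !H.
Qed.

Lemma qprod_zero (L : C) (a : nat -> C) (n : nat) (u : C) :
  qprod L a n (fun _ => 0) u = 0.
Proof.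
  induction n as [|n IH]; simpl; [easy|].
  transitivity (qprod L a n (fun _ => 0) u); [|exact IH].
  apply qprod_ext. intros v. unfold qshift. ring.
Qed.

(** The range starts at 1 so that index 0, reserved for the theta solution, stays apart from the
    indices that carry an exponent [a j]. *)
Fixpoint psum (n : nat) (G : nat -> C -> C) (u : C) : C :=
  match n with
  | O => 0
  | S k => psum k G u + G (S k) u
  end.

Lemma psum_mero_eq (n : nat) (G G' : nat -> C -> C) :
  (forall j, (1 <= j <= n)%nat -> mero_eq (G j) (G' j)) ->
  mero_eq (psum n G) (psum n G').
Proof.
  induction n as [|n IH]; intros H; [apply mero_eq_refl|].
  apply (mero_eq_imp2 (psum n G) (psum n G') (G (S n)) (G' (S n))).
  - intros u E1 E2. simpl. now rewrite E1, E2.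
  - apply IH. intros j Hj. apply H. lia.
  - apply H. lia.
Qed.

Lemma psum_lin (n : nat) (G G' : nat -> C -> C) (c u : C) :
  psum n G u + c * psum n G' u = psum n (fun j u => G j u + c * G' j u) u.
Proof.
  induction n as [|n IH]; simpl; [ring|]. rewrite <- IH. ring.
Qed.

Lemma psum_shift (n : nat) (G : nat -> C -> C) (s u : C) :
  psum n G (u + s) = psum n (fun j u => G j (u + s)) u.
Proof. induction n as [|n IH]; simpl; [easy|]. now rewrite IH. Qed.

Lemma psum_zero (n : nat) (u : C) : psum n (fun _ _ => 0) u = 0.
Proof. induction n as [|n IH]; simpl; [easy|]. rewrite IH. ring. Qed.

Lemma meromorphic_psum (n : nat) (G : nat -> C -> C) :
  (forall j, (1 <= j <= n)%nat -> meromorphic (G j)) -> meromorphic (psum n G).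
Proof.
  induction n as [|n IH]; intros H; simpl; [apply meromorphic_const|].
  apply (meromorphic_plus (psum n G)).
  - apply IH. intros j Hj. apply H. lia.
  - apply H. lia.
Qed.

Lemma sum_n_psum (n : nat) (G : nat -> C -> C) (u : C) :
  sum_n (fun j => G j u) n = G 0%nat u + psum n G u.
Proof.
  induction n as [|n IH].
  - rewrite sum_O. simpl. ring.
  - rewrite sum_Sn, IH. simpl. change plus with Cplus. ring.
Qed.

(** * The powers [x^(a j)] over the periodic functions *)

Lemma Cdiff_Cexp_mult (c z : C) : Cdiff (fun u => Cexp (c * u)) z.
Proof.
  apply (Cdiff_comp Cexp (fun u => c * u)); [apply Cdiff_Cexp|].
  apply Cdiff_mult; [apply Cdiff_const|apply Cdiff_id].
Qed.

Lemma Cexp_mult_shift (c u L : C) : Cexp (c * (u + L)) = Cexp (c * L) * Cexp (c * u).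
Proof. rewrite <- Cexp_plus. f_equal. ring. Qed.

Section Exponentials.

Variables (L : C) (a : nat -> C).

Let b (j : nat) : C := Cexp (a j * L).
Let e (j : nat) (u : C) : C := Cexp (a j * u).

(** The factor of index [k] multiplies [e j] by [b j - b k], which is 0 for [k = j]. The scalar [c]
    is arbitrary so that it can absorb the factors already applied. *)
Lemma qprod_exponential (n : nat) (c u : C) (j : nat) : (1 <= j <= n)%nat ->
  qprod L a n (fun u => c * e j u) u = 0.
Proof.
  revert c. induction n as [|n IH]; intros c Hj; [lia|]. simpl.
  rewrite (qprod_ext _ _ _ _ (fun u => c * (b j - b (S n)) * e j u)).
  2:{ intros v. unfold qshift, e. rewrite Cexp_mult_shift. fold (b j) (b (S n)). ring. }
  destruct (Nat.eq_dec j (S n)) as [->|Hn].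
  - rewrite (qprod_ext _ _ _ _ (fun _ => 0)) by (intros v; ring).
    apply qprod_zero.
  - apply IH. lia.
Qed.

(** Elimination as for eigenvectors: periodic coefficients commute with [T], so [T - b (S n)]
    removes the last term and multiplies the j-th by the nonzero number [b j - b (S n)]. Once the
    lower coefficients vanish, the last one stands alone before an exponential without zeros. *)
Lemma exponentials_independent (n : nat) (c : nat -> C -> C) :
  (forall j k, (1 <= j <= n)%nat -> (1 <= k <= n)%nat -> j <> k -> b j <> b k) ->
  (forall j, (1 <= j <= n)%nat -> mero_eq (qshift L (c j)) (c j)) ->
  mero_eq (psum n (fun j u => c j u * e j u)) (fun _ => 0) ->
  forall j, (1 <= j <= n)%nat -> mero_eq (c j) (fun _ => 0).
Proof.
  revert c. induction n as [|n IH]; intros c Hb Hc H j Hj; [lia|].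
  assert (Hlow : forall j, (1 <= j <= n)%nat -> mero_eq (c j) (fun _ => 0)).
  { intros k Hk.
    assert (Hbk : b k - b (S n) <> 0).
    { intros E. apply (Hb k (S n)); try lia.
      replace (b k) with (b k - b (S n) + b (S n)) by ring. rewrite E. ring. }
    assert (Hz : mero_eq (fun u => (b k - b (S n)) * c k u) (fun _ => 0)).
    { apply (IH (fun j u => (b j - b (S n)) * c j u)); auto.
      - intros i l Hi Hl. apply Hb; lia.
      - intros i Hi. apply (mero_eq_imp (qshift L (c i)) (c i)); [|apply Hc; lia].
        unfold qshift. now intros u ->.
      - set (F := fun j u => c j u * e j u) in *.
        apply mero_eq_trans with (fun u => psum (S n) (fun j u => qshift L (F j) u + - b (S n) * F j u) u).
        + apply mero_eq_trans with (psum (S n) (fun j u => (b j - b (S n)) * c j u * e j u)).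
          (* The term of index [S n] has the factor [b (S n) - b (S n) = 0], so extending the sum by
             it changes nothing. *)
          * apply mero_eq_ext. intros u. simpl. ring.
          * apply psum_mero_eq. intros i Hi.
            apply (mero_eq_imp (qshift L (c i)) (c i)); [|apply Hc; lia].
            unfold qshift, F, e. intros u ->. rewrite Cexp_mult_shift. fold (b i). ring.
        + apply mero_eq_shift with (s := L) in H as H'.
          refine (mero_eq_imp2 _ _ _ _ _ _ _ H H'). intros u E1 E2.
           unfold qshift in *. rewrite psum_shift in E2.
          rewrite <- (psum_lin (S n) (fun j u => F j (u + L)) F).
          rewrite E1, E2. ring. }
    revert Hz. apply mero_eq_imp. intros u E.
    replace (c k u) with (/ (b k - b (S n)) * ((b k - b (S n)) * c k u))
      by (field; exact Hbk).
    rewrite E. ring. }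
  destruct (Nat.eq_dec j (S n)) as [->|Hn]; [|apply Hlow; lia].
  assert (Hs : mero_eq (psum n (fun j u => c j u * e j u)) (psum n (fun _ _ => 0))).
  { apply psum_mero_eq. intros i Hi. generalize (Hlow i Hi).
    apply mero_eq_imp. intros u ->. ring. }
  refine (mero_eq_imp2 _ _ _ _ _ _ _ H Hs). intros u E1 E2.
   simpl in *. rewrite psum_zero in E2. rewrite E2 in E1.
  pose proof (Cexp_neq_0 (a (S n) * u)) as Hn. fold (e (S n) u) in Hn.
  replace (c (S n) u) with ((0 + c (S n) u * e (S n) u) / e (S n) u) by (field; auto).
  rewrite E1. field; auto.
Qed.

(** By induction [(T - b (S n)) h] is a combination of the first [n] exponentials. Dividing its
    coefficients by [b j - b (S n)] gives a combination [D] with the same image under [T - b (S n)];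
    then [h - D] is killed by this factor, so it is a periodic multiple of the last exponential. *)
Lemma exponentials_span (n : nat) (h : C -> C) :
  (forall j k, (1 <= j <= n)%nat -> (1 <= k <= n)%nat -> j <> k -> b j <> b k) ->
  meromorphic h -> mero_eq (qprod L a n h) (fun _ => 0) ->
  exists c : nat -> C -> C,
    (forall j, (1 <= j <= n)%nat -> qperiodic L (c j)) /\
    mero_eq h (psum n (fun j u => c j u * e j u)).
Proof.
  revert h. induction n as [|n IH]; intros h Hb Hh H.
  - exists (fun _ _ => 0). split; [lia|exact H].
  - simpl in H. destruct (IH (fun u => qshift L h u - b (S n) * h u)) as [c [Hc Hs]].
    + intros i l Hi Hl. apply Hb; lia.
    + apply (meromorphic_ext (fun u => h (u + L) + - b (S n) * h u)).
      * apply mero_eq_ext. intros u. unfold qshift. ring.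
      * apply meromorphic_plus; [now apply meromorphic_shift|].
        apply meromorphic_mult; [apply meromorphic_const|easy].
    + exact H.
    + clear H.
      set (d := fun j u => / (b j - b (S n)) * c j u).
      set (D := fun j u => d j u * e j u).
      assert (Hnz : forall j, (1 <= j <= n)%nat -> b j - b (S n) <> 0).
      { intros k Hk E. apply (Hb k (S n)); try lia.
        replace (b k) with (b k - b (S n) + b (S n)) by ring. rewrite E. ring. }
      assert (Hd : forall j, (1 <= j <= n)%nat -> qperiodic L (d j)).
      { intros j Hj. destruct (Hc j Hj) as [H1 H2]. split.
        - apply meromorphic_mult; [apply meromorphic_const|easy].
        - revert H2. apply mero_eq_imp. unfold qshift, d. now intros u ->. }
      (* The quotient of [h - D] by the last exponential, written as a product so that it is visibly
         meromorphic. *)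
      set (t := fun u => (h u + - (1) * psum n D u) * Cexp (- a (S n) * u)).
      assert (HDm : meromorphic (psum n D)).
      { apply meromorphic_psum. intros j Hj. apply meromorphic_mult.
        - apply (Hd j Hj).
        - apply meromorphic_entire. intros z. apply Cdiff_Cexp_mult. }
      exists (fun j => if Nat.eq_dec j (S n) then t else d j). split.
      * intros j Hj. destruct (Nat.eq_dec j (S n)) as [->|Hn]; [|apply Hd; lia].
        split.
        -- apply meromorphic_mult.
           ++ apply meromorphic_plus; [easy|].
              apply meromorphic_mult; [apply meromorphic_const|easy].
           ++ apply meromorphic_entire. intros z. apply Cdiff_Cexp_mult.
        -- assert (HD : mero_eq (fun u => psum n D (u + L) + - b (S n) * psum n D u)
                          (psum n (fun j u => c j u * e j u))).
           { apply mero_eq_trans with (psum n (fun j u => D j (u + L) + - b (S n) * D j u)).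
             - apply mero_eq_ext. intros u. rewrite psum_shift. apply psum_lin.
             - apply psum_mero_eq. intros j Hj'. destruct (Hc j Hj') as [_ H2].
               revert H2. apply mero_eq_imp. unfold qshift, D, d, e. intros u ->.
               rewrite Cexp_mult_shift. fold (b j). field. now apply Hnz. }
           refine (mero_eq_imp2 _ _ _ _ _ _ _ Hs HD). intros u E1 E2.
            simpl in *. unfold qshift, t in *. rewrite <- E2 in E1.
           rewrite Cexp_mult_shift.
           replace (Cexp (- a (S n) * L)) with (/ b (S n))
             by (unfold b; rewrite <- Cexp_opp; f_equal; ring).
           assert (Hbn : b (S n) <> 0) by apply Cexp_neq_0.
           replace (h (u + L)) with
             ((h (u + L) - b (S n) * h u) + b (S n) * h u) by ring.
           rewrite E1. field. exact Hbn.
      * apply mero_eq_ext. intros u. cbn [psum].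
        destruct (Nat.eq_dec (S n) (S n)) as [_|Hx]; [|easy].
        assert (Hps : forall k, (k <= n)%nat ->
          psum k (fun j u0 => (if Nat.eq_dec j (S n) then t else d j) u0 * e j u0) u
          = psum k D u).
        { induction k as [|k IHk]; intros Hk; cbn [psum]; [easy|].
          rewrite IHk by lia. destruct (Nat.eq_dec (S k) (S n)); [lia|reflexivity]. }
        rewrite Hps by lia. unfold t, e.
        pose proof (Cexp_neq_0 (a (S n) * u)).
        replace (- a (S n) * u) with (- (a (S n) * u)) by ring. rewrite Cexp_opp.
        field. auto.
Qed.

End Exponentials.

(** * Fundamental solutions of the factored operator *)

Lemma meromorphic_first_order (L : C) (X g : C -> C) :
  (forall z, Cdiff X z) -> meromorphic g ->
  meromorphic (fun u => qshift L g u + X u * g u).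
Proof.
  intros HX Hg. apply meromorphic_plus; [now apply meromorphic_shift|].
  apply meromorphic_mult; [now apply meromorphic_entire|easy].
Qed.

(** Isolates what theta and [mu] must supply. With [X = x q^alpha], applying [T + X] to a linear
    relation leaves a relation between the [x^(a j)], which kills the coefficients of positive
    index; multiplying by [F] then kills the one of index 0. For spanning, the expansion of
    [(T + X) g] in the [x^(a j)] is matched by a combination of the [f j], [j >= 1]; the difference
    [t] satisfies [T t = - X t], and [F t] is periodic. The inverse [F] of [f 0] is a parameter so
    that its meromorphy is given and not derived. *)
Lemma fundamental_solutions_factored (L alpha : C) (a : nat -> C) (n : nat)
    (f : nat -> C -> C) (F : C -> C) (K : nat -> C) :
  (forall j k, (1 <= j <= n)%nat -> (1 <= k <= n)%nat -> j <> k ->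
     Cexp (a j * L) <> Cexp (a k * L)) ->
  meromorphic F -> (forall j, (j <= n)%nat -> meromorphic (f j)) ->
  mero_eq (fun u => F u * f 0%nat u) (fun _ => 1) ->
  mero_eq (fun u => qshift L (f 0%nat) u + Cexp u * Cexp (alpha * L) * f 0%nat u)
    (fun _ => 0) ->
  (forall j, (1 <= j <= n)%nat -> K j <> 0 /\
     mero_eq (fun u => qshift L (f j) u + Cexp u * Cexp (alpha * L) * f j u)
       (fun u => K j * Cexp (a j * u))) ->
  fundamental_solutions L (S n) (qdiff_op L alpha a (S n)) f.
Proof.
  intros Hb HF Hf HFf H0 HK.
  unfold fundamental_solutions, solution, qdiff_op, lincomb.
  replace (S n - 1)%nat with n by lia.
  set (X := fun u => Cexp u * Cexp (alpha * L)) in *.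
  assert (HX : forall z, Cdiff X z).
  { intros z. apply Cdiff_mult; [apply Cdiff_Cexp|apply Cdiff_const]. }
  split; [|split].
  - intros j Hj. split; [apply Hf; lia|].
    destruct j as [|j].
    + apply mero_eq_trans with (qprod L a n (fun _ => 0)).
      * now apply qprod_mero_eq.
      * apply mero_eq_ext. intros u. apply qprod_zero.
    + destruct (HK (S j) ltac:(lia)) as [_ HKj].
      apply mero_eq_trans with (qprod L a n (fun u => K (S j) * Cexp (a (S j) * u))).
      * now apply qprod_mero_eq.
      * apply mero_eq_ext. intros u. apply qprod_exponential. lia.
  - intros c Hc H.
    assert (Hs : mero_eq (psum n (fun j u => (c j u * K j) * Cexp (a j * u))) (fun _ => 0)).
    { set (G := fun j u => c j u * f j u) in *.
      apply mero_eq_trans with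
        (psum n (fun j u => G j (u + L) + X u * G j u)).
      - apply psum_mero_eq. intros j Hj. destruct (HK j Hj) as [_ HKj].
        refine (mero_eq_imp2 _ _ _ _ _ _ _ (proj2 (Hc j ltac:(lia))) HKj).
        intros u E1 E2. unfold G, qshift in *. rewrite E1, <- Cmult_assoc, <- E2.
        unfold X. ring.
      - assert (HG0 : mero_eq (fun u => G 0%nat (u + L) + X u * G 0%nat u) (fun _ => 0)).
        { refine (mero_eq_imp2 _ _ _ _ _ _ _ (proj2 (Hc 0%nat ltac:(lia))) H0).
          intros u E1 E2. unfold G, qshift in *. rewrite E1.
          replace (c 0%nat u * f 0%nat (u + L) + X u * (c 0%nat u * f 0%nat u))
            with (c 0%nat u * (f 0%nat (u + L) + Cexp u * Cexp (alpha * L) * f 0%nat u))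
            by (unfold X; ring).
          rewrite E2. ring. }
        assert (Ht : mero_eq (fun u => sum_n (fun j => G j (u + L)) n
                              + X u * sum_n (fun j => G j u) n) (fun _ => 0)).
        { refine (mero_eq_imp2 _ _ _ _ _ _ _ (mero_eq_shift L _ _ H) H).
          intros u E1 E2. unfold qshift, G in *. rewrite E1, E2. ring. }
        refine (mero_eq_imp2 _ _ _ _ _ _ _ Ht HG0).
        intros u E1 E2. rewrite (sum_n_psum n G u), (sum_n_psum n G (u + L)), psum_shift in E1.
        assert (Hlin : psum n (fun j u0 => G j (u0 + L)) u + X u * psum n G u
          = psum n (fun j u => G j (u + L) + X u * G j u) u).
        { clear. induction n as [|n IH]; simpl; [ring|]. rewrite <- IH. ring. }
        rewrite <- Hlin.
        replace (psum n (fun j u0 => G j (u0 + L)) u + X u * psum n G u)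
          with (G 0%nat (u + L) + psum n (fun j u0 => G j (u0 + L)) u
                + X u * (G 0%nat u + psum n G u) - (G 0%nat (u + L) + X u * G 0%nat u))
          by ring.
        rewrite E1, E2. ring. }
    assert (Hpos : forall j, (1 <= j <= n)%nat -> mero_eq (c j) (fun _ => 0)).
    { intros j Hj. destruct (HK j Hj) as [HKj _].
      generalize (exponentials_independent L a n (fun j u => c j u * K j) Hb).
      intros HI. specialize (HI (fun k Hk =>
        mero_eq_imp _ _ _ _ (fun u E => f_equal (fun v => v * K k) E)
          (proj2 (Hc k ltac:(lia)))) Hs j Hj).
      revert HI. apply mero_eq_imp. intros u E.
      replace (c j u) with (c j u * K j / K j) by (field; easy).
      rewrite E. field. easy. }
    intros [|j] Hj; [|apply Hpos; lia].
    assert (Hz : mero_eq (psum n (fun j u => c j u * f j u)) (psum n (fun _ _ => 0))).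
    { apply psum_mero_eq. intros j Hj'. generalize (Hpos j Hj').
      apply mero_eq_imp. intros u ->. ring. }
    assert (Hc0 : mero_eq (fun u => c 0%nat u * f 0%nat u) (fun _ => 0)).
    { refine (mero_eq_imp2 _ _ _ _ _ _ _ H Hz). intros u E1 E2.
      rewrite (sum_n_psum n (fun j u => c j u * f j u)), E2, psum_zero in E1.
      rewrite <- E1. ring. }
    refine (mero_eq_imp2 _ _ _ _ _ _ _ Hc0 HFf). intros u E1 E2.
    replace (c 0%nat u) with (c 0%nat u * (F u * f 0%nat u)) by (rewrite E2; ring).
    replace (c 0%nat u * (F u * f 0%nat u)) with (c 0%nat u * f 0%nat u * F u) by ring.
    rewrite E1. ring.
  - intros g [Hg Hs].
    destruct (exponentials_span L a n (fun u => qshift L g u + X u * g u) Hb) as [c [Hc Hh]].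
    { now apply meromorphic_first_order. }
    { exact Hs. }
    set (d := fun j u => c j u * / K j).
    assert (Hd : forall j, (1 <= j <= n)%nat -> qperiodic L (d j)).
    { intros j Hj. destruct (Hc j Hj) as [H1 H2]. split.
      - apply meromorphic_mult; [easy|apply meromorphic_const].
      - revert H2. apply mero_eq_imp. unfold qshift, d. now intros u ->. }
    set (D := fun j u => d j u * f j u).
    set (t := fun u => g u + - (1) * psum n D u).
    assert (Ht : mero_eq (fun u => t (u + L) + X u * t u) (fun _ => 0)).
    { assert (HD : mero_eq (psum n (fun j u => D j (u + L) + X u * D j u))
                     (psum n (fun j u => c j u * Cexp (a j * u)))).
      { apply psum_mero_eq. intros j Hj. destruct (HK j Hj) as [HKn HKj].
        refine (mero_eq_imp2 _ _ _ _ _ _ _ (proj2 (Hd j Hj)) HKj).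
        intros u E1 E2. unfold D, qshift in *. rewrite E1.
        replace (d j u * f j (u + L) + X u * (d j u * f j u))
          with (d j u * (f j (u + L) + Cexp u * Cexp (alpha * L) * f j u))
          by (unfold X; ring).
        rewrite E2. unfold d. field. easy. }
      refine (mero_eq_imp2 _ _ _ _ _ _ _ Hh HD). intros u E1 E2.
      rewrite <- E2 in E1. unfold t, qshift in *.
      assert (Hlin : psum n D (u + L) + X u * psum n D u
          = psum n (fun j u => D j (u + L) + X u * D j u) u).
      { clear. induction n as [|n IH]; simpl; [ring|]. rewrite <- IH. ring. }
      rewrite <- Hlin in E1.
      replace (g (u + L) + - (1) * psum n D (u + L) + X u * (g u + - (1) * psum n D u))
        with (g (u + L) + X u * g u - (psum n D (u + L) + X u * psum n D u)) by ring.
      rewrite E1. ring. }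
    exists (fun j => match j with O => fun u => F u * t u | S _ => d j end). split.
    + intros [|j] Hj; [|apply Hd; lia]. split.
      * apply meromorphic_mult; [easy|]. apply meromorphic_plus; [easy|].
        apply meromorphic_mult; [apply meromorphic_const|].
        apply meromorphic_psum. intros j Hj'. apply meromorphic_mult.
        -- apply (Hd j Hj').
        -- apply Hf. lia.
      (* Both sides are inverses of [f 0]: the shifted relation [F f 0 = 1] is combined with
         [T (f 0) = - X f 0]. *)
      * assert (HFT : mero_eq (fun u => F (u + L) * - X u) F).
        { assert (HT : mero_eq (fun u => F (u + L) * - X u * f 0%nat u) (fun _ => 1)).
          { refine (mero_eq_imp2 _ _ _ _ _ _ _ (mero_eq_shift L _ _ HFf) H0).
            intros u E1 E2. unfold qshift in *. rewrite <- E1.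
            replace (f 0%nat (u + L)) with
              (f 0%nat (u + L) + Cexp u * Cexp (alpha * L) * f 0%nat u - X u * f 0%nat u)
              by (unfold X; ring).
            rewrite E2. ring. }
          refine (mero_eq_imp2 _ _ _ _ _ _ _ HT HFf). intros u E1 E2.
          replace (F u) with ((F (u + L) * - X u * f 0%nat u) * F u) by (rewrite E1; ring).
          replace (F (u + L) * - X u) with (F (u + L) * - X u * (F u * f 0%nat u)) at 1
            by (rewrite E2; ring).
          ring. }
        refine (mero_eq_imp2 _ _ _ _ _ _ _ Ht HFT). intros u E1 E2.
        unfold qshift. rewrite <- E2.
        replace (t (u + L)) with (t (u + L) + X u * t u - X u * t u) by ring.
        rewrite E1. ring.
    + refine (mero_eq_imp _ _ _ _ _ HFf). intros u E.
      rewrite (sum_n_psum n (fun j u => (match j with O => fun u => F u * t u | S _ => d j end) u * f j u)).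
      assert (Hps : forall k, psum k (fun j u =>
          (match j with O => fun u => F u * t u | S _ => d j end) u * f j u) u = psum k D u).
      { induction k as [|k IH]; simpl; [easy|]. now rewrite IH. }
      rewrite Hps.
      replace (F u * t u * f 0%nat u) with (F u * f 0%nat u * t u) by ring.
      rewrite E. unfold t. ring.
Qed.

(** * Absolutely convergent series *)

Definition Csummable (a : nat -> C) : Prop := ex_series (fun n => Cmod (a n)).

Lemma Csummable_le (a : nat -> C) (b : nat -> R) :
  (forall n, Cmod (a n) <= b n)%R -> ex_series b -> Csummable a.
Proof.
  intros H Hb. apply (@ex_series_le R_AbsRing R_CompleteNormedModule _ b); [|easy].
  intros n. change (Rabs (Cmod (a n)) <= b n)%R.
  rewrite Rabs_pos_eq; [apply H|apply Cmod_ge_0].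
Qed.

Lemma Csummable_eventually_le (a : nat -> C) (b : nat -> R) (N : nat) :
  (forall n, (N <= n)%nat -> (Cmod (a n) <= b n)%R) -> ex_series b -> Csummable a.
Proof.
  intros H Hb. unfold Csummable. apply (ex_series_incr_n _ N).
  apply (ex_series_incr_n _ N) in Hb.
  apply (Csummable_le (fun k => a (N + k)%nat) (fun k => b (N + k)%nat)); [|easy].
  intros n. apply H. lia.
Qed.

Lemma ex_series_Re (a : nat -> C) : Csummable a -> ex_series (fun n => Re (a n)).
Proof.
  apply (@ex_series_le R_AbsRing R_CompleteNormedModule).
  intros n. apply re_le_Cmod.
Qed.

Lemma ex_series_Im (a : nat -> C) : Csummable a -> ex_series (fun n => Im (a n)).
Proof.
  apply (@ex_series_le R_AbsRing R_CompleteNormedModule).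
  intros n. apply Im_le_Cmod.
Qed.

Lemma Csummable_plus (a b : nat -> C) :
  Csummable a -> Csummable b -> Csummable (fun n => a n + b n).
Proof.
  intros Ha Hb. apply (Csummable_le _ (fun n => Cmod (a n) + Cmod (b n))%R).
  - intros n. apply Cmod_triangle.
  - now apply (@ex_series_plus R_AbsRing R_NormedModule).
Qed.

Lemma Csummable_scal (c : C) (a : nat -> C) :
  Csummable a -> Csummable (fun n => c * a n).
Proof.
  intros Ha. apply (Csummable_le _ (fun n => Cmod c * Cmod (a n))%R).
  - intros n. rewrite Cmod_mult. lra.
  - now apply (@ex_series_scal_l R_AbsRing).
Qed.

Lemma Csummable_ext (a b : nat -> C) :
  (forall n, a n = b n) -> Csummable a -> Csummable b.
Proof. intros H. apply ex_series_ext. intros n. now rewrite H. Qed.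

Lemma CSeries_ext (a b : nat -> C) : (forall n, a n = b n) -> CSeries a = CSeries b.
Proof. intros H. unfold CSeries. f_equal; apply Series_ext; intros n; now rewrite H. Qed.

Lemma CSeries_plus (a b : nat -> C) : Csummable a -> Csummable b ->
  CSeries (fun n => a n + b n) = CSeries a + CSeries b.
Proof.
  intros Ha Hb. unfold CSeries, Cplus at 3; simpl. f_equal.
  - rewrite <- Series_plus; [easy|now apply ex_series_Re|now apply ex_series_Re].
  - rewrite <- Series_plus; [easy|now apply ex_series_Im|now apply ex_series_Im].
Qed.

Lemma CSeries_scal (c : C) (a : nat -> C) : Csummable a ->
  CSeries (fun n => c * a n) = c * CSeries a.
Proof.
  intros Ha. pose proof (ex_series_Re a Ha) as HR. pose proof (ex_series_Im a Ha) as HI.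
  unfold CSeries, Cmult at 3; simpl. f_equal.
  - rewrite <- !Series_scal_l, <- Series_minus.
    + easy.
    + now apply (@ex_series_scal_l R_AbsRing).
    + now apply (@ex_series_scal_l R_AbsRing).
  - rewrite <- !Series_scal_l, <- Series_plus.
    + easy.
    + now apply (@ex_series_scal_l R_AbsRing).
    + now apply (@ex_series_scal_l R_AbsRing).
Qed.

Lemma CSeries_incr_1 (a : nat -> C) : Csummable a ->
  CSeries a = a 0%nat + CSeries (fun n => a (S n)).
Proof.
  intros Ha. unfold CSeries, Cplus; simpl.
  rewrite (Series_incr_1 _ (ex_series_Re a Ha)), (Series_incr_1 _ (ex_series_Im a Ha)).
  easy.
Qed.

(** Real and imaginary parts are bounded separately, hence the factor 2. *)
Lemma Cmod_CSeries_le (a : nat -> C) (b : nat -> R) :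
  (forall n, Cmod (a n) <= b n)%R -> ex_series b ->
  (Cmod (CSeries a) <= 2 * Series b)%R.
Proof.
  intros H Hb. unfold CSeries.
  assert (HA : forall g : C -> R, (forall z, Rabs (g z) <= Cmod z)%R ->
    (Rabs (Series (fun n => g (a n))) <= Series b)%R).
  { intros g Hg.
    assert (Hle : forall n, (0 <= Rabs (g (a n)) <= b n)%R).
    { intros n. split; [apply Rabs_pos|]. eapply Rle_trans; [apply Hg|apply H]. }
    eapply Rle_trans; [apply Series_Rabs|now apply Series_le].
    apply (@ex_series_le R_AbsRing R_CompleteNormedModule _ b); [|easy].
    intros n. change (Rabs (Rabs (g (a n))) <= b n)%R. rewrite Rabs_Rabsolu. apply Hle. }
  eapply Rle_trans; [apply Cmod_le_abs|].
  pose proof (HA Re re_le_Cmod). pose proof (HA Im Im_le_Cmod). lra.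
Qed.

(** * Two-sided series *)

Definition Zsummable (a : Z -> C) : Prop :=
  Csummable (fun n => a (Z.of_nat n)) /\ Csummable (fun n => a (- Z.of_nat (S n))%Z).

Lemma Zsummable_plus (a b : Z -> C) :
  Zsummable a -> Zsummable b -> Zsummable (fun n => a n + b n).
Proof.
  intros [H1 H2] [H3 H4]. split.
  - apply (Csummable_plus _ _ H1 H3).
  - apply (Csummable_plus _ _ H2 H4).
Qed.

Lemma Zsummable_scal (c : C) (a : Z -> C) :
  Zsummable a -> Zsummable (fun n => c * a n).
Proof.
  intros [H1 H2]. split.
  - apply (Csummable_scal c _ H1).
  - apply (Csummable_scal c _ H2).
Qed.

Lemma Zsummable_ext (a b : Z -> C) :
  (forall n, a n = b n) -> Zsummable a -> Zsummable b.
Proof.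
  intros H [H1 H2]. split.
  - revert H1. apply Csummable_ext. intros n. apply H.
  - revert H2. apply Csummable_ext. intros n. apply H.
Qed.

Lemma Zsummable_le (a b : Z -> C) (K : R) :
  (forall n, Cmod (a n) <= K * Cmod (b n))%R -> Zsummable b -> Zsummable a.
Proof.
  intros H [H1 H2]. split.
  - apply (Csummable_le _ (fun n => K * Cmod (b (Z.of_nat n)))%R).
    + intros n. apply H.
    + now apply (@ex_series_scal_l R_AbsRing).
  - apply (Csummable_le _ (fun n => K * Cmod (b (- Z.of_nat (S n))%Z))%R).
    + intros n. apply H.
    + now apply (@ex_series_scal_l R_AbsRing).
Qed.

Lemma CSeriesZ_ext (a b : Z -> C) : (forall n, a n = b n) -> CSeriesZ a = CSeriesZ b.
Proof. intros H. unfold CSeriesZ. f_equal; apply CSeries_ext; intros n; apply H. Qed.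

Lemma CSeriesZ_plus (a b : Z -> C) : Zsummable a -> Zsummable b ->
  CSeriesZ (fun n => a n + b n) = CSeriesZ a + CSeriesZ b.
Proof.
  intros [H1 H2] [H3 H4]. unfold CSeriesZ.
  rewrite (CSeries_plus _ _ H1 H3), (CSeries_plus _ _ H2 H4). ring.
Qed.

Lemma CSeriesZ_scal (c : C) (a : Z -> C) : Zsummable a ->
  CSeriesZ (fun n => c * a n) = c * CSeriesZ a.
Proof.
  intros [H1 H2]. unfold CSeriesZ.
  rewrite (CSeries_scal c _ H1), (CSeries_scal c _ H2). ring.
Qed.

Lemma Zsummable_succ (a : Z -> C) :
  Zsummable (fun n => a (n + 1)%Z) <-> Zsummable a.
Proof.
  assert (E1 : forall n, a (Z.of_nat n + 1)%Z = a (Z.of_nat (S n))).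
  { intros n. f_equal. lia. }
  assert (E2 : forall n, a (- Z.of_nat (S n) + 1)%Z = a (- Z.of_nat n)%Z).
  { intros n. f_equal. lia. }
  unfold Zsummable. split; intros [H1 H2]; split.
  - unfold Csummable. apply ex_series_incr_1. revert H1. apply Csummable_ext. apply E1.
  - apply (Csummable_ext _ _ E2) in H2. unfold Csummable in H2.
    apply (proj1 (ex_series_incr_1 _)) in H2. exact H2.
  - apply (Csummable_ext (fun n => a (Z.of_nat (S n)))); [intros n; now rewrite E1|].
    exact (proj1 (ex_series_incr_1 _) H1).
  - apply (Csummable_ext (fun n => a (- Z.of_nat n)%Z)); [intros n; now rewrite E2|].
    unfold Csummable. apply ex_series_incr_1. exact H2.
Qed.

(** Reindexing only moves the term [a 0] from the nonnegative half to the negative half. *)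
Lemma CSeriesZ_succ (a : Z -> C) : Zsummable a ->
  CSeriesZ (fun n => a (n + 1)%Z) = CSeriesZ a.
Proof.
  intros Ha. pose proof (proj2 (Zsummable_succ a) Ha) as Hs.
  destruct Ha as [H1 _]. destruct Hs as [_ H2].
  unfold CSeriesZ. rewrite (CSeries_incr_1 _ H1), (CSeries_incr_1 _ H2).
  rewrite (CSeries_ext (fun n => a (Z.of_nat n + 1)%Z) (fun n => a (Z.of_nat (S n))))
    by (intros n; f_equal; lia).
  rewrite (CSeries_ext (fun n => a (- Z.of_nat (S (S n)) + 1)%Z)
             (fun n => a (- Z.of_nat (S n))%Z))
    by (intros n; f_equal; lia).
  change (- Z.of_nat 1 + 1)%Z with 0%Z. change (Z.of_nat 0) with 0%Z. ring.
Qed.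

(* Uniform second-order remainders replace the usual termwise-differentiation theorem. *)
Lemma CSeries_Cdiff (f : nat -> C -> C) (d : nat -> C) (M : nat -> R) (w : C) (r : R) :
  (0 < r)%R ->
  (forall n z, (Cmod (z - w) < r)%R ->
     (Cmod (f n z - f n w - d n * (z - w)) <= M n * Cmod (z - w) ^ 2)%R) ->
  (forall z, (Cmod (z - w) < r)%R -> Csummable (fun n => f n z)) ->
  Csummable d -> ex_series M ->
  Cdiff (fun z => CSeries (fun n => f n z)) w.
Proof.
  intros Hr H Hf Hd HM.
  apply (Cderiv_Cdiff _ _ (CSeries d)).
  apply (Cderiv_quadratic _ _ _ (2 * Series M) r Hr). intros z Hz.
  assert (Hw : Csummable (fun n => f n w)).
  { apply Hf. replace (w - w) with (RtoC 0) by ring. now rewrite Cmod_0. }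
  replace (CSeries (fun n => f n z) - CSeries (fun n => f n w) - CSeries d * (z - w))
    with (CSeries (fun n => f n z + - (1) * f n w + - (z - w) * d n)).
  - rewrite Rmult_assoc, <- Series_scal_r.
    apply Cmod_CSeries_le.
    + intros n. replace (f n z + - (1) * f n w + - (z - w) * d n)
        with (f n z - f n w - d n * (z - w)) by ring. now apply H.
    + now apply (@ex_series_scal_r).
  - rewrite CSeries_plus, CSeries_plus, !CSeries_scal; auto.
    + ring.
    + now apply Csummable_scal.
    + apply Csummable_plus; [now apply Hf|now apply Csummable_scal].
    + now apply Csummable_scal.
Qed.

(** * Differentiability of power series and of partial fraction series *)

Lemma INR_succ_le_pow2 (n : nat) : (INR (S n) <= 2 ^ S n)%R.
Proof.
  induction n as [|n IH]; [simpl; lra|].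
  rewrite S_INR. simpl pow in *.
  assert (1 <= 2 ^ n)%R by (apply pow_R1_Rle; lra). lra.
Qed.

(** The remainders satisfy [R_(k+1) = z R_k + k w^(k-1) (z - w)^2]. Bounding the factor [k] by [2^k]
    keeps the estimate geometric: both summands are then at most [r (2r)^k |z - w|^2]. *)
Lemma Cpow_remainder (z w : C) (r : R) (n : nat) :
  (1 <= r)%R -> (Cmod z <= r)%R -> (Cmod w <= r)%R ->
  (Cmod (z ^ S n - w ^ S n - RtoC (INR (S n)) * w ^ n * (z - w))
   <= (2 * r) ^ S n * Cmod (z - w) ^ 2)%R.
Proof.
  intros Hr Hz Hw.
  induction n as [|n IH].
  - replace (z ^ 1 - w ^ 1 - RtoC (INR 1) * w ^ 0 * (z - w)) with (RtoC 0)
      by (simpl; ring).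
    rewrite Cmod_0. apply Rmult_le_pos; apply pow_le; [lra|apply Cmod_ge_0].
  - replace (z ^ S (S n) - w ^ S (S n) - RtoC (INR (S (S n))) * w ^ S n * (z - w))
      with (z * (z ^ S n - w ^ S n - RtoC (INR (S n)) * w ^ n * (z - w))
            + RtoC (INR (S n)) * w ^ n * ((z - w) * (z - w))).
    2:{ rewrite (S_INR (S n)), RtoC_plus. simpl Cpow. ring. }
    eapply Rle_trans; [apply Cmod_triangle|].
    rewrite !Cmod_mult, Cmod_pow, Cmod_R, (Rabs_pos_eq _ (pos_INR _)).
    set (m := Cmod (z - w)) in *.
    assert (Hm : (0 <= m * m)%R) by (apply Rmult_le_pos; apply Cmod_ge_0).
    pose proof (INR_succ_le_pow2 n) as Hn.
    assert (Hwn : (Cmod w ^ n <= r ^ n)%R) by (apply pow_incr; split; [apply Cmod_ge_0|easy]).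
    assert (Hrn : (r ^ n <= r ^ S n)%R) by (apply Rle_pow; [easy|lia]).
    assert (Hp : (0 <= r ^ S n)%R) by (apply pow_le; lra).
    assert (H2 : (0 < 2 ^ S n)%R) by (apply pow_lt; lra).
    assert (HA : (INR (S n) * Cmod w ^ n * (m * m) <= (2 * r) ^ S n * r * (m * m))%R).
    { apply Rmult_le_compat_r; [easy|].
      rewrite Rpow_mult_distr.
      apply Rle_trans with (2 ^ S n * r ^ S n)%R.
      - apply Rmult_le_compat; [apply pos_INR|apply pow_le, Cmod_ge_0|easy|lra].
      - assert (0 <= 2 ^ S n * r ^ S n)%R by (apply Rmult_le_pos; lra). nra. }
    assert (HB : (Cmod z * Cmod (z ^ S n - w ^ S n - RtoC (INR (S n)) * w ^ n * (z - w))
                  <= r * ((2 * r) ^ S n * m ^ 2))%R).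
    { apply Rmult_le_compat; auto; apply Cmod_ge_0. }
    eapply Rle_trans; [apply Rplus_le_compat; [apply HB|apply HA]|].
    right. simpl. ring.
Qed.

(** The remainder estimate for powers costs a doubled radius, which is harmless because convergence
    is assumed at every radius. *)
Lemma entire_power_series (c : nat -> C) (w : C) :
  (forall r : R, (0 < r)%R -> ex_series (fun n => Cmod (c n) * r ^ n)%R) ->
  Cdiff (fun z => CSeries (fun n => c n * z ^ n)) w.
Proof.
  intros Hc. pose proof (Cmod_ge_0 w) as Hw0.
  set (r := (Cmod w + 1)%R).
  assert (Hz : forall z, (Cmod (z - w) < 1)%R -> (Cmod z <= r)%R).
  { intros z H. pose proof (Cmod_triangle_inv z w). unfold r. lra. }
  apply (CSeries_Cdiff _
    (fun n => match n with O => 0 | S k => c n * (RtoC (INR n) * w ^ k) end)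
    (fun n => Cmod (c n) * (2 * r) ^ n)%R w 1).
  - lra.
  - intros [|n] z H.
    + replace (c 0%nat * z ^ 0 - c 0%nat * w ^ 0 - 0 * (z - w)) with (RtoC 0) by (simpl; ring).
      rewrite Cmod_0. apply Rmult_le_pos; [|apply pow_le, Cmod_ge_0].
      apply Rmult_le_pos; [apply Cmod_ge_0|apply pow_le; unfold r; lra].
    + replace (c (S n) * z ^ S n - c (S n) * w ^ S n - c (S n) * (RtoC (INR (S n)) * w ^ n) * (z - w))
        with (c (S n) * (z ^ S n - w ^ S n - RtoC (INR (S n)) * w ^ n * (z - w))) by ring.
      rewrite Cmod_mult, Rmult_assoc.
      apply Rmult_le_compat_l; [apply Cmod_ge_0|].
      apply Cpow_remainder; [unfold r; lra|now apply Hz|unfold r; lra].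
  - intros z H. apply (Csummable_le _ (fun n => Cmod (c n) * r ^ n)%R).
    + intros n. rewrite Cmod_mult, Cmod_pow.
      apply Rmult_le_compat_l; [apply Cmod_ge_0|].
      apply pow_incr. split; [apply Cmod_ge_0|now apply Hz].
    + apply Hc. unfold r. lra.
  - apply (Csummable_le _ (fun n => Cmod (c n) * (2 * r) ^ n)%R); [|apply Hc; unfold r; lra].
    intros [|n].
    + rewrite Cmod_0. apply Rmult_le_pos; [apply Cmod_ge_0|simpl; lra].
    + rewrite !Cmod_mult, Cmod_pow, Cmod_R, (Rabs_pos_eq _ (pos_INR _)).
      apply Rmult_le_compat_l; [apply Cmod_ge_0|].
      rewrite Rpow_mult_distr. apply Rmult_le_compat.
      * apply pos_INR.
      * apply pow_le, Cmod_ge_0.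
      * apply INR_succ_le_pow2.
      * apply Rle_trans with (r ^ n)%R.
        -- apply pow_incr. unfold r. lra.
        -- apply Rle_pow; [unfold r; lra|lia].
  - apply Hc. unfold r. lra.
Qed.

(** The remainder of one fraction is [p^2 (z - w)^2 / ((1 - z p)(1 - w p)^2)]. The weight [1 + |p|]
    in the lower bound makes both [1/(1 - z p)] and [p/(1 - w p)] at most [1/c], so the constant
    [c^(-3)] serves even for unbounded [p n], such as negative powers of [q]. *)
Lemma partial_fractions_Cdiff (b p : nat -> C) (w : C) (c r : R) :
  (0 < r)%R -> (0 < c)%R -> Csummable b ->
  (forall n z, (Cmod (z - w) < r)%R -> (c * (1 + Cmod (p n)) <= Cmod (1 - z * p n))%R) ->
  Cdiff (fun z => CSeries (fun n => b n / (1 - z * p n))) w.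
Proof.
  intros Hr Hc Hb H.
  assert (Hpos : forall n z, (Cmod (z - w) < r)%R ->
    (0 < c * (1 + Cmod (p n)))%R /\ 1 - z * p n <> 0).
  { intros n z Hz. pose proof (Cmod_ge_0 (p n)).
    assert (0 < c * (1 + Cmod (p n)))%R by (apply Rmult_lt_0_compat; lra).
    split; [easy|]. apply Cmod_gt_0. pose proof (H n z Hz). lra. }
  assert (Hinv : forall n z, (Cmod (z - w) < r)%R ->
    (Cmod (/ (1 - z * p n)) <= / c * / (1 + Cmod (p n)))%R).
  { intros n z Hz. destruct (Hpos n z Hz) as [H1 H2]. rewrite Cmod_inv by easy.
    rewrite <- Rinv_mult. apply Rinv_le_contravar; [easy|now apply H]. }
  assert (Hww : (Cmod (w - w) < r)%R).
  { replace (w - w) with (RtoC 0) by ring. now rewrite Cmod_0. }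
  assert (Hc' : (0 < / c)%R) by now apply Rinv_0_lt_compat.
  assert (Hq : forall n, (0 < / (1 + Cmod (p n)) <= 1)%R /\
     (Cmod (p n) * / (1 + Cmod (p n)) <= 1)%R).
  { intros n. pose proof (Cmod_ge_0 (p n)). repeat split.
    - apply Rinv_0_lt_compat. lra.
    - rewrite <- Rinv_1. apply Rinv_le_contravar; lra.
    - apply Rmult_le_reg_r with (1 + Cmod (p n))%R; [lra|].
      rewrite Rmult_assoc, Rinv_l; lra. }
  apply (CSeries_Cdiff _ (fun n => b n * (p n * (/ (1 - w * p n) * / (1 - w * p n))))
    (fun n => Cmod (b n) * (/ c * (/ c * / c)))%R w r Hr).
  - intros n z Hz. destruct (Hpos n z Hz) as [_ H1]. destruct (Hpos n w Hww) as [_ H2].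
    replace (b n / (1 - z * p n) - b n / (1 - w * p n) -
       b n * (p n * (/ (1 - w * p n) * / (1 - w * p n))) * (z - w))
      with (b n * ((/ (1 - z * p n)) * ((p n * / (1 - w * p n)) * (p n * / (1 - w * p n))))
             * ((z - w) * (z - w)))
      by (field; auto).
    rewrite !Cmod_mult. simpl pow. rewrite Rmult_1_r.
    apply Rmult_le_compat_r; [apply Rmult_le_pos; apply Cmod_ge_0|].
    apply Rmult_le_compat_l; [apply Cmod_ge_0|].
    destruct (Hq n) as [Hq1 Hq2].
    assert (HA : (Cmod (/ (1 - z * p n)) <= / c)%R).
    { eapply Rle_trans; [now apply Hinv|]. nra. }
    assert (HB : (Cmod (p n) * Cmod (/ (1 - w * p n)) <= / c)%R).
    { eapply Rle_trans; [apply Rmult_le_compat_l; [apply Cmod_ge_0|now apply Hinv]|]. nra. }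
    assert (HB0 : (0 <= Cmod (p n) * Cmod (/ (1 - w * p n)))%R)
      by (apply Rmult_le_pos; apply Cmod_ge_0).
    apply Rmult_le_compat; auto using Cmod_ge_0.
    + now apply Rmult_le_pos.
    + now apply Rmult_le_compat.
  - intros z Hz. apply (Csummable_le _ (fun n => / c * Cmod (b n))%R).
    + intros n. unfold Cdiv. rewrite Cmod_mult, Rmult_comm.
      apply Rmult_le_compat_r; [apply Cmod_ge_0|].
      destruct (Hq n) as [Hq1 Hq2]. eapply Rle_trans; [now apply Hinv|]. nra.
    + now apply (@ex_series_scal_l R_AbsRing).
  - apply (Csummable_le _ (fun n => (/ c * / c) * Cmod (b n))%R).
    + intros n. rewrite !Cmod_mult, Rmult_comm.
      apply Rmult_le_compat_r; [apply Cmod_ge_0|].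
      destruct (Hq n) as [Hq1 Hq2].
      assert (HA : (Cmod (/ (1 - w * p n)) <= / c)%R).
      { eapply Rle_trans; [now apply Hinv|]. nra. }
      assert (HB : (Cmod (p n) * Cmod (/ (1 - w * p n)) <= / c)%R).
      { eapply Rle_trans; [apply Rmult_le_compat_l; [apply Cmod_ge_0|now apply Hinv]|]. nra. }
      rewrite <- Rmult_assoc.
      apply Rmult_le_compat; auto using Cmod_ge_0.
      apply Rmult_le_pos; apply Cmod_ge_0.
    + now apply (@ex_series_scal_l R_AbsRing).
  - now apply ex_series_scal_r.
Qed.

(** * Theta series *)

Lemma RtoC_neq (a b : R) : a <> b -> RtoC a <> RtoC b.
Proof. intros H E. apply H. now apply RtoC_inj. Qed.

Lemma Cpowz_of_nat (x : C) (n : nat) : Cpowz x (Z.of_nat n) = x ^ n.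
Proof.
  destruct n as [|n]; [easy|].
  change (x ^ Pos.to_nat (Pos.of_succ_nat n) = x ^ S n). now rewrite SuccNat2Pos.id_succ.
Qed.

Lemma Cpowz_opp_of_nat (x : C) (n : nat) : Cpowz x (- Z.of_nat n) = / x ^ n.
Proof.
  destruct n as [|n].
  - simpl. field.
  - change (/ x ^ Pos.to_nat (Pos.of_succ_nat n) = / x ^ S n). now rewrite SuccNat2Pos.id_succ.
Qed.

Lemma Cpowz_succ (x : C) (n : Z) : x <> 0 -> Cpowz x (n + 1) = Cpowz x n * x.
Proof.
  intros Hx. destruct (Z.le_gt_cases 0 n) as [H|H].
  - rewrite <- (Z2Nat.id n H).
    replace (Z.of_nat (Z.to_nat n) + 1)%Z with (Z.of_nat (S (Z.to_nat n))) by lia.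
    rewrite !Cpowz_of_nat. simpl. ring.
  - replace n with (- Z.of_nat (S (Z.to_nat (- n - 1))))%Z by lia.
    set (k := Z.to_nat (- n - 1)).
    replace (- Z.of_nat (S k) + 1)%Z with (- Z.of_nat k)%Z by lia.
    rewrite !Cpowz_opp_of_nat. simpl. field. split; [now apply Cpow_nz|easy].
Qed.

Lemma Z_two_sided_ind (P : Z -> Prop) :
  P 0%Z -> (forall n, P n <-> P (n + 1)%Z) -> forall n, P n.
Proof.
  intros H0 HS n. destruct (Z.le_gt_cases 0 n) as [H|H].
  - rewrite <- (Z2Nat.id n H). induction (Z.to_nat n) as [|k IH]; [easy|].
    apply HS in IH. now replace (Z.of_nat (S k)) with (Z.of_nat k + 1)%Z by lia.
  - replace n with (- Z.of_nat (Z.to_nat (- n)))%Z by lia.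
    induction (Z.to_nat (- n)) as [|k IH]; [easy|].
    apply HS. now replace (- Z.of_nat (S k) + 1)%Z with (- Z.of_nat k)%Z by lia.
Qed.

Lemma Cpowz_neq_0 (x : C) (n : Z) : x <> 0 -> Cpowz x n <> 0.
Proof.
  intros Hx. revert n. apply Z_two_sided_ind.
  - apply RtoC_neq. lra.
  - intros n. rewrite (Cpowz_succ x n Hx). split.
    + intros H. now apply Cmult_neq_0.
    + intros H E. apply H. rewrite E. ring.
Qed.

Lemma Cmult_reg_r (a b x : C) : x <> 0 -> a * x = b * x -> a = b.
Proof.
  intros Hx H. replace a with (a * x / x) by (field; easy).
  rewrite H. field. easy.
Qed.

Lemma Cpowz_add (x : C) (m n : Z) : x <> 0 -> Cpowz x (m + n) = Cpowz x m * Cpowz x n.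
Proof.
  intros Hx. revert n. apply Z_two_sided_ind.
  - rewrite Z.add_0_r. simpl. ring.
  - intros n. rewrite Z.add_assoc, !(Cpowz_succ x _ Hx), Cmult_assoc. split.
    + now intros ->.
    + now apply Cmult_reg_r.
Qed.

Lemma Cpowz_opp (x : C) (n : Z) : x <> 0 -> Cpowz x (- n) = / Cpowz x n.
Proof.
  intros Hx. pose proof (Cpowz_neq_0 x n Hx) as Hn.
  apply (Cmult_reg_r _ _ (Cpowz x n) Hn).
  rewrite <- Cpowz_add, Z.add_opp_diag_l by easy. simpl. field. easy.
Qed.

Lemma Cpowz_mult (x y : C) (n : Z) : x <> 0 -> y <> 0 ->
  Cpowz (x * y) n = Cpowz x n * Cpowz y n.
Proof.
  intros Hx Hy. revert n. apply Z_two_sided_ind.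
  - simpl. ring.
  - intros n. rewrite !Cpowz_succ by (auto using Cmult_neq_0).
    replace (Cpowz x n * x * (Cpowz y n * y)) with (Cpowz x n * Cpowz y n * (x * y)) by ring.
    split.
    + now intros ->.
    + apply Cmult_reg_r. now apply Cmult_neq_0.
Qed.

Lemma Copp_neq_0 (x : C) : x <> 0 -> - x <> 0.
Proof. intros H E. apply H. replace x with (- - x) by ring. rewrite E. ring. Qed.

Lemma Cinv_neq_0 (x : C) : x <> 0 -> / x <> 0.
Proof.
  intros H E. assert (H1 : x * / x = 1) by (field; easy).
  rewrite E in H1. apply (RtoC_neq 1 0); [lra|]. rewrite <- H1. ring.
Qed.

Definition theta_term (q x : C) (n : Z) : C := Cpowz x n * Cpowz q (n * (n - 1) / 2).

Lemma triangular_succ (n : Z) : ((n + 1) * (n + 1 - 1) / 2 = n * (n - 1) / 2 + n)%Z.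
Proof.
  replace ((n + 1) * (n + 1 - 1))%Z with (n * (n - 1) + n * 2)%Z by ring.
  now rewrite Z.div_add.
Qed.

Lemma theta_term_succ (q x : C) (n : Z) : q <> 0 -> x <> 0 ->
  theta_term q x (n + 1) = x * Cpowz q n * theta_term q x n.
Proof.
  intros Hq Hx. unfold theta_term.
  rewrite triangular_succ, (Cpowz_succ x), (Cpowz_add q) by easy. ring.
Qed.

Lemma theta_term_neq_0 (q x : C) (n : Z) : q <> 0 -> x <> 0 -> theta_term q x n <> 0.
Proof. intros Hq Hx. apply Cmult_neq_0; now apply Cpowz_neq_0. Qed.

Lemma theta_term_mult (q x : C) (n : Z) : q <> 0 -> x <> 0 ->
  theta_term q (x * q) n = Cpowz q n * theta_term q x n.
Proof. intros Hq Hx. unfold theta_term. rewrite Cpowz_mult by easy. ring. Qed.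

Lemma Csummable_ratio (a : nat -> C) (K rho : R) :
  (0 <= rho < 1)%R -> (forall n, a n <> 0) ->
  (forall n, Cmod (a (S n)) <= K * rho ^ n * Cmod (a n))%R -> Csummable a.
Proof.
  intros Hrho Ha H.
  apply (ex_series_ext (fun n => Rabs (Cmod (a n)))).
  { intros n. apply Rabs_pos_eq, Cmod_ge_0. }
  apply (ex_series_DAlembert _ 0); [lra| |].
  { intros n E. apply (Ha n). now apply Cmod_eq_0. }
  apply is_lim_seq_le_le with (fun _ => 0%R) (fun n => K * rho ^ n)%R.
  - intros n. split; [apply Rabs_pos|].
    assert (Hp : (0 < Cmod (a n))%R) by (apply Cmod_gt_0, Ha).
    rewrite Rabs_pos_eq.
    + apply Rle_div_l; [easy|]. apply H.
    + apply Rmult_le_pos; [apply Cmod_ge_0|]. left. now apply Rinv_0_lt_compat.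
  - apply is_lim_seq_const.
  - replace (Finite 0) with (Rbar_mult K 0) by (simpl; f_equal; ring).
    apply is_lim_seq_scal_l. apply is_lim_seq_geom. rewrite Rabs_pos_eq; lra.
Qed.

Lemma Zsummable_theta_term (q x : C) :
  q <> 0 -> (Cmod q < 1)%R -> x <> 0 -> Zsummable (theta_term q x).
Proof.
  intros Hq Hq1 Hx. pose proof (Cmod_ge_0 q) as Hq0. split.
  - apply (Csummable_ratio _ (Cmod x) (Cmod q)); [lra| |].
    + intros n. now apply theta_term_neq_0.
    + intros n. replace (Z.of_nat (S n)) with (Z.of_nat n + 1)%Z by lia.
      rewrite theta_term_succ, !Cmod_mult, Cpowz_of_nat, Cmod_pow by easy. lra.
  - apply (Csummable_ratio _ (Cmod (q * q * / x)) (Cmod q)); [lra| |].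
    + intros n. now apply theta_term_neq_0.
    + intros n. rewrite <- Cmod_pow, <- !Cmod_mult. right. f_equal.
      replace (- Z.of_nat (S n))%Z with (- Z.of_nat (S (S n)) + 1)%Z by lia.
      rewrite theta_term_succ, Cpowz_opp_of_nat by easy. simpl.
      field. repeat split; auto. now apply Cpow_nz.
Qed.

(** The n-th term at [x q] is [1/x] times the (n+1)-st term at [x]. *)
Lemma theta_shift (q x : C) : q <> 0 -> (Cmod q < 1)%R -> x <> 0 ->
  theta q (x * q) = / x * theta q x.
Proof.
  intros Hq Hq1 Hx. unfold theta.
  pose proof (Zsummable_theta_term q x Hq Hq1 Hx) as Hs.
  change (CSeriesZ (theta_term q (x * q)) = / x * CSeriesZ (theta_term q x)).
  rewrite <- (CSeriesZ_succ _ Hs), <- CSeriesZ_scal.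
  - apply CSeriesZ_ext. intros n.
    rewrite theta_term_mult, theta_term_succ by easy. field. easy.
  - now apply Zsummable_succ.
Qed.

(** The Laurent series is an entire power series in [x] plus [1/x] times an entire power series in
    [1/x]; [d n] is the coefficient of [x^(-n-1)]. *)
Lemma Cdiff_theta (q x : C) : q <> 0 -> (Cmod q < 1)%R -> x <> 0 -> Cdiff (theta q) x.
Proof.
  intros Hq Hq1 Hx.
  set (c := fun n => Cpowz q (Z.of_nat n * (Z.of_nat n - 1) / 2)).
  set (d := fun n => Cpowz q (- Z.of_nat (S n) * (- Z.of_nat (S n) - 1) / 2)).
  assert (Hc : forall r : R, (0 < r)%R -> ex_series (fun n => Cmod (c n) * r ^ n)%R).
  { intros r Hr. assert (Hr0 : RtoC r <> 0) by (apply RtoC_neq; lra).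
    destruct (Zsummable_theta_term q r Hq Hq1 Hr0) as [H _].
    revert H. apply ex_series_ext. intros n. unfold theta_term.
    rewrite Cpowz_of_nat, Cmod_mult, Cmod_pow, Cmod_R, Rabs_pos_eq by lra.
    apply Rmult_comm. }
  assert (Hd : forall r : R, (0 < r)%R -> ex_series (fun n => Cmod (d n) * r ^ n)%R).
  { intros r Hr.
    (* The negative half of theta at [1/r] has terms of modulus [|d n| r^(n+1)]; the surplus power
       of [r] is divided out. *)
    assert (Hr1 : (0 < / r)%R) by now apply Rinv_0_lt_compat.
    assert (Hr0 : RtoC (/ r) <> 0) by (apply RtoC_neq; lra).
    destruct (Zsummable_theta_term q (/ r)%R Hq Hq1 Hr0) as [_ H].
    apply (ex_series_scal_l (/ r)%R) in H.
    revert H. apply ex_series_ext. intros n. unfold theta_term.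
    rewrite Cpowz_opp_of_nat, Cmod_mult, Cmod_inv, Cmod_pow, Cmod_R, Rabs_pos_eq
      by (try lra; now apply Cpow_nz).
    change scal with Rmult. fold (d n). simpl. rewrite pow_inv. field.
    split; [apply pow_nonzero; lra|lra]. }
  apply (Cdiff_ext_near (fun x => CSeries (fun n => c n * x ^ n)
    + / x * CSeries (fun n => d n * (/ x) ^ n))).
  - apply locally_Cmod. exists (Cmod x). split; [now apply Cmod_gt_0|].
    intros y Hy.
    assert (Hy0 : y <> 0).
    { intros ->. rewrite Cmod_minus_sym in Hy.
      replace (x - 0) with x in Hy by ring. lra. }
    unfold theta, CSeriesZ. f_equal.
    + apply CSeries_ext. intros n. rewrite Cpowz_of_nat. unfold c. ring.
    + rewrite <- CSeries_scal.
      * apply CSeries_ext. intros n. rewrite Cpowz_opp_of_nat. fold (d n).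
        rewrite Cpow_inv by easy. simpl. field. split; [now apply Cpow_nz|easy].
      * apply (Csummable_le _ (fun n => Cmod (d n) * (Cmod (/ y)) ^ n)%R).
        -- intros n. rewrite Cmod_mult, Cmod_pow. lra.
        -- apply Hd, Cmod_gt_0, Cinv_neq_0, Hy0.
  - apply Cdiff_plus; [now apply entire_power_series|].
    apply Cdiff_mult; [now apply Cdiff_inv|].
    apply (Cdiff_comp (fun z => CSeries (fun n => d n * z ^ n)) Cinv).
    + now apply entire_power_series.
    + now apply Cdiff_inv.
Qed.

(** * The finite Jacobi triple product *)

Fixpoint Cprod (f : nat -> C) (n : nat) : C :=
  match n with
  | O => 1
  | S k => Cprod f k * f k
  end.

Lemma Cprod_add (f : nat -> C) (m n : nat) :
  Cprod f (m + n) = Cprod f m * Cprod (fun k => f (m + k)%nat) n.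
Proof.
  induction n as [|n IH].
  - rewrite Nat.add_0_r. simpl. ring.
  - rewrite Nat.add_succ_r. simpl. rewrite IH. ring.
Qed.

Lemma geom_partial_le (rho : R) (n : nat) : (0 <= rho < 1)%R ->
  (0 <= / (1 - rho) - rho ^ n / (1 - rho) <= / (1 - rho))%R.
Proof.
  intros H. assert (0 < / (1 - rho))%R by (apply Rinv_0_lt_compat; lra).
  assert (0 <= rho ^ n <= 1)%R.
  { split; [apply pow_le; lra|]. rewrite <- (pow1 n). apply pow_incr. lra. }
  unfold Rdiv. nra.
Qed.

(** Put [t = tau rho^k] and [s = tau / (1 - tau)]. Since [(1 + s rho^k)(1 - t) >= 1], the factor
    [|1 + z k| >= 1 - t] is at least [exp (- s rho^k)]; it is at most [1 + t <= exp (s rho^k)]. The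
    exponents sum geometrically, with a bound independent of [n]. *)
Lemma Cprod_bounds (z : nat -> C) (tau rho : R) (n : nat) :
  (0 <= tau < 1)%R -> (0 <= rho < 1)%R ->
  (forall k, Cmod (z k) <= tau * rho ^ k)%R ->
  (exp (- (tau / (1 - tau) * / (1 - rho))) <= Cmod (Cprod (fun k => 1 + z k)%C n)
   <= exp (tau / (1 - tau) * / (1 - rho)))%R.
Proof.
  intros Ht Hrho Hz.
  set (s := (tau / (1 - tau))%R).
  assert (Hs : (0 <= s)%R).
  { apply Rmult_le_pos; [lra|]. left. apply Rinv_0_lt_compat. lra. }
  (* The exact partial sum of the exponents: the induction needs it in place of its limit. *)
  set (S := fun n => (s * (/ (1 - rho) - rho ^ n / (1 - rho)))%R).
  assert (HS : (exp (- S n) <= Cmod (Cprod (fun k => 1 + z k)%C n) <= exp (S n))%R).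
  { induction n as [|n IH].
    - simpl. rewrite Cmod_1. unfold S. simpl.
      replace (s * (/ (1 - rho) - 1 / (1 - rho)))%R with 0%R by (field; lra).
      rewrite Ropp_0, exp_0. lra.
    - simpl Cprod. rewrite Cmod_mult.
      assert (HSn : (S (Datatypes.S n) = S n + s * rho ^ n)%R)
        by (unfold S; simpl; field; lra).
      rewrite HSn, Ropp_plus_distr, !exp_plus.
      set (t := (tau * rho ^ n)%R).
      assert (Hr : (0 <= rho ^ n <= 1)%R).
      { split; [apply pow_le; lra|]. rewrite <- (pow1 n). apply pow_incr. lra. }
      assert (Htt : (0 <= t <= tau)%R) by (unfold t; nra).
      pose proof (Hz n) as Hzn. fold t in Hzn.
      assert (Hup : (Cmod (1 + z n) <= 1 + t)%R).
      { eapply Rle_trans; [apply Cmod_triangle|]. rewrite Cmod_1. lra. }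
      assert (Hlo : (1 - t <= Cmod (1 + z n))%R).
      { pose proof (Cmod_triangle_inv 1 (- z n)) as H. rewrite Cmod_1, Cmod_opp in H.
        replace (1 - - z n) with (1 + z n) in H by ring. lra. }
      assert (Hst : (t <= s * rho ^ n * (1 - t))%R).
      { replace (s * rho ^ n)%R with (t / (1 - tau))%R by (unfold s, t; field; lra).
        unfold Rdiv. rewrite Rmult_assoc. rewrite <- (Rmult_1_r t) at 1.
        apply Rmult_le_compat_l; [lra|]. rewrite Rmult_comm.
        apply Rle_div_r; lra. }
      pose proof (exp_ineq1_le (s * rho ^ n)) as He.
      pose proof (exp_pos (- (s * rho ^ n))) as Hp.
      assert (Hsp : (0 <= s * rho ^ n)%R) by (apply Rmult_le_pos; lra).
      assert (He2 : (exp (- (s * rho ^ n)) <= 1 - t)%R).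
      { rewrite exp_Ropp. apply Rmult_le_reg_l with (exp (s * rho ^ n)); [apply exp_pos|].
        rewrite Rinv_r by (pose proof (exp_pos (s * rho ^ n)); lra).
        apply Rle_trans with ((1 + s * rho ^ n) * (1 - t))%R.
        - nra.
        - apply Rmult_le_compat_r; lra. }
      pose proof (exp_pos (- S n)). pose proof (exp_pos (S n)).
      pose proof (Cmod_ge_0 (1 + z n)).
      split.
      + apply Rmult_le_compat; lra.
      + apply Rmult_le_compat; try lra.
        eapply Rle_trans; [apply Hup|]. nra. }
  pose proof (geom_partial_le rho n Hrho) as Hg.
  assert (HSb : (S n <= s * / (1 - rho))%R) by (unfold S; apply Rmult_le_compat_l; lra).
  assert (Hexp : forall x y, (x <= y)%R -> (exp x <= exp y)%R).
  { intros x y [H| ->]; [left; now apply exp_increasing|lra]. }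
  split.
  - eapply Rle_trans; [|apply HS]. apply Hexp. lra.
  - eapply Rle_trans; [apply HS|]. apply Hexp. lra.
Qed.

(** The q-Pochhammer symbol [(q;q)_n], with factors in the shape [1 + z k] of [Cprod_bounds]. *)
Definition qfact (q : C) (n : nat) : C := Cprod (fun k => 1 + - q ^ S k) n.

(* [1/(q;q)_k], set to [0] for negative [k] so that [inv_qfact_succ] holds on all of Z. *)
Definition inv_qfact (q : C) (k : Z) : C :=
  if Z_lt_dec k 0 then 0 else / qfact q (Z.to_nat k).

Lemma qfact_bounds (q : C) : (Cmod q < 1)%R ->
  exists B : R, (1 <= B)%R /\ forall n, (/ B <= Cmod (qfact q n) <= B)%R.
Proof.
  intros Hq1. pose proof (Cmod_ge_0 q) as Hq0.
  set (s := (Cmod q / (1 - Cmod q) * / (1 - Cmod q))%R).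
  exists (exp s). split.
  - rewrite <- exp_0.
    assert (H : (0 <= s)%R).
    { assert (0 < / (1 - Cmod q))%R by (apply Rinv_0_lt_compat; lra).
      unfold s, Rdiv. apply Rmult_le_pos; [apply Rmult_le_pos|]; lra. }
    destruct H as [H|H]; [left; now apply exp_increasing|rewrite <- H; lra].
  - intros n. rewrite <- exp_Ropp. unfold qfact, s.
    apply Cprod_bounds; [lra|lra|].
    intros k. rewrite Cmod_opp, Cmod_pow. simpl. lra.
Qed.

Lemma qfact_neq_0 (q : C) (n : nat) : (Cmod q < 1)%R -> qfact q n <> 0.
Proof.
  intros Hq1. destruct (qfact_bounds q Hq1) as [B [HB H]].
  apply Cmod_gt_0. eapply Rlt_le_trans; [|apply H]. apply Rinv_0_lt_compat. lra.
Qed.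

Lemma one_minus_qpow_neq_0 (q : C) (k : nat) : (Cmod q < 1)%R -> 1 - q ^ S k <> 0.
Proof.
  intros Hq1 E. apply (qfact_neq_0 q (S k) Hq1).
  change (qfact q k * (1 + - q ^ S k) = 0).
  replace (1 + - q ^ S k) with (1 - q ^ S k) by ring. rewrite E. ring.
Qed.

Lemma inv_qfact_succ (q : C) (k : Z) : q <> 0 -> (Cmod q < 1)%R ->
  inv_qfact q k = (1 - Cpowz q (k + 1)) * inv_qfact q (k + 1).
Proof.
  intros Hq Hq1. unfold inv_qfact.
  destruct (Z_lt_dec k 0) as [H|H], (Z_lt_dec (k + 1) 0) as [H'|H']; try lia.
  - ring.
  (* At [k = -1] the factor [1 - q^0] vanishes, in agreement with the default value 0. *)
  - replace (k + 1)%Z with 0%Z by lia. simpl. ring.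
  - replace (k + 1)%Z with (Z.of_nat (S (Z.to_nat k))) by lia.
    rewrite Cpowz_of_nat, Nat2Z.id. unfold qfact. simpl Cprod.
    fold (qfact q (Z.to_nat k)).
    pose proof (qfact_neq_0 q (Z.to_nat k) Hq1).
    pose proof (one_minus_qpow_neq_0 q (Z.to_nat k) Hq1) as Hn.
    simpl in *. field. split; [|easy].
    intros E. apply Hn. rewrite <- E. ring.
Qed.

Lemma inv_qfact_bound (q : C) (B : R) : (1 <= B)%R ->
  (forall n, (/ B <= Cmod (qfact q n) <= B)%R) -> forall k, (Cmod (inv_qfact q k) <= B)%R.
Proof.
  intros HB H k. unfold inv_qfact. destruct (Z_lt_dec k 0); [rewrite Cmod_0; lra|].
  assert (HBi : (0 < / B)%R) by (apply Rinv_0_lt_compat; lra).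
  pose proof (proj1 (H (Z.to_nat k))) as Hk.
  rewrite Cmod_inv by (apply Cmod_gt_0; lra).
  rewrite <- (Rinv_inv B). apply Rinv_le_contravar; lra.
Qed.

(** The Gaussian binomial coefficient of [2n] over [n + j]; the default of [inv_qfact] makes it 0
    for [|j| > n]. *)
Definition jtp_coeff (q : C) (n : nat) (j : Z) : C :=
  qfact q (2 * n) * inv_qfact q (Z.of_nat n + j) * inv_qfact q (Z.of_nat n - j).

(** The part of the partial triple product that depends on [x]; the Pochhammer factors are kept
    apart as a normalisation. *)
Definition theta_prod (q x : C) (n : nat) : C :=
  Cprod (fun k => (1 + x * q ^ k) * (1 + q ^ S k / x)) n.

(* With [A = q^(n+1+j)] and [B = q^(n+1-j)] this reduces to
   [(1+AB/q)(1-A)(1-B) + B(1-A)(1-A/q) + A(1-B)(1-B/q) = (1-AB/q)(1-AB)]. *)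
Lemma jtp_coeff_succ (q : C) (n : nat) (j : Z) : q <> 0 -> (Cmod q < 1)%R ->
  jtp_coeff q (S n) j =
  (1 + q ^ (2 * n + 1)) * jtp_coeff q n j
  + q ^ n * Cpowz q (1 - j) * jtp_coeff q n (j - 1)
  + q ^ S n * Cpowz q j * jtp_coeff q n (j + 1).
Proof.
  intros Hq Hq1. unfold jtp_coeff.
  replace (2 * S n)%nat with (S (S (2 * n))) by lia.
  assert (EG : qfact q (S (S (2 * n))) =
    qfact q (2 * n) * (1 - q ^ S (2 * n)) * (1 - q ^ S (S (2 * n)))).
  { unfold qfact. simpl Cprod. simpl. ring. }
  rewrite EG.
  set (N := Z.of_nat n).
  replace (Z.of_nat (S n)) with (N + 1)%Z by (unfold N; lia).
  set (Ha := inv_qfact q (N + 1 + j)). set (Hb := inv_qfact q (N + 1 - j)).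
  set (P := Cpowz q j).
  assert (HP : P <> 0) by now apply Cpowz_neq_0.
  assert (EQ : Cpowz q N = q ^ n) by apply Cpowz_of_nat.
  assert (Hqn : q ^ n <> 0) by now apply Cpow_nz.
  assert (EA : Cpowz q (N + 1 + j) = q ^ n * q * P).
  { rewrite !Cpowz_add by easy. rewrite EQ. unfold P. simpl Cpowz. simpl. ring. }
  assert (EB : Cpowz q (N + 1 - j) = q ^ n * q / P).
  { unfold Z.sub. rewrite !Cpowz_add, Cpowz_opp by easy. rewrite EQ. fold P.
    simpl Cpowz. simpl. field. easy. }
  assert (EA' : Cpowz q (N + j) = q ^ n * P).
  { rewrite !Cpowz_add by easy. rewrite EQ. easy. }
  assert (EB' : Cpowz q (N - j) = q ^ n / P).
  { unfold Z.sub. rewrite !Cpowz_add, Cpowz_opp by easy. rewrite EQ. fold P. field. easy. }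
  assert (E1 : inv_qfact q (N + j) = (1 - q ^ n * q * P) * Ha).
  { rewrite (inv_qfact_succ q _ Hq Hq1).
    replace (N + j + 1)%Z with (N + 1 + j)%Z by lia. now rewrite EA. }
  assert (E2 : inv_qfact q (N - j) = (1 - q ^ n * q / P) * Hb).
  { rewrite (inv_qfact_succ q _ Hq Hq1).
    replace (N - j + 1)%Z with (N + 1 - j)%Z by lia. now rewrite EB. }
  assert (E3 : inv_qfact q (N + (j - 1)) = (1 - q ^ n * P) * ((1 - q ^ n * q * P) * Ha)).
  { rewrite (inv_qfact_succ q _ Hq Hq1).
    replace (N + (j - 1) + 1)%Z with (N + j)%Z by lia. now rewrite EA', E1. }
  assert (E4 : inv_qfact q (N - (j + 1)) = (1 - q ^ n / P) * ((1 - q ^ n * q / P) * Hb)).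
  { rewrite (inv_qfact_succ q _ Hq Hq1).
    replace (N - (j + 1) + 1)%Z with (N - j)%Z by lia. now rewrite EB', E2. }
  replace (N - (j - 1))%Z with (N + 1 - j)%Z by lia.
  replace (N + (j + 1))%Z with (N + 1 + j)%Z by lia.
  fold Ha Hb. rewrite E1, E2, E3, E4.
  replace (Cpowz q (1 - j)) with (q / P).
  2:{ unfold Z.sub. rewrite Cpowz_add, Cpowz_opp by easy. fold P. simpl. field. easy. }
  replace (q ^ S (2 * n)) with (q ^ n * q ^ n * q)
    by (replace (S (2 * n))%nat with (n + n + 1)%nat by lia; rewrite !Cpow_add_r; simpl; ring).
  replace (q ^ S (S (2 * n))) with (q ^ n * q ^ n * q * q)
    by (replace (S (S (2 * n)))%nat with (n + n + 2)%nat by lia; rewrite !Cpow_add_r; simpl; ring).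
  replace (q ^ (2 * n + 1)) with (q ^ n * q ^ n * q)
    by (replace (2 * n + 1)%nat with (n + n + 1)%nat by lia; rewrite !Cpow_add_r; simpl; ring).
  replace (q ^ S n) with (q * q ^ n) by (simpl; ring).
  field. easy.
Qed.

Lemma Zsummable_jtp (q x : C) (n : nat) : q <> 0 -> (Cmod q < 1)%R -> x <> 0 ->
  Zsummable (fun j => jtp_coeff q n j * theta_term q x j).
Proof.
  intros Hq Hq1 Hx. destruct (qfact_bounds q Hq1) as [B [HB H]].
  apply (Zsummable_le _ (theta_term q x) (B * B * B)).
  - intros j. rewrite Cmod_mult. apply Rmult_le_compat_r; [apply Cmod_ge_0|].
    unfold jtp_coeff. rewrite !Cmod_mult.
    pose proof (inv_qfact_bound q B HB H).
    apply Rmult_le_compat; auto using Cmod_ge_0.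
    + apply Rmult_le_pos; apply Cmod_ge_0.
    + apply Rmult_le_compat; auto using Cmod_ge_0. apply H.
  - now apply Zsummable_theta_term.
Qed.

Lemma CSeries_zero : CSeries (fun _ => 0) = 0.
Proof.
  assert (H : Series (fun _ => 0%R) = 0%R).
  { rewrite (Series_ext _ (fun _ => 0 * 0)%R) by (intros; ring).
    rewrite Series_scal_l. ring. }
  unfold CSeries. simpl. now rewrite H.
Qed.

(** The new factor is [(1 + x q^n)(1 + q^(n+1)/x) = (1 + q^(2n+1)) + x q^n + q^(n+1)/x]; its last
    two terms shift the index by one in either direction, which is the recurrence of the
    coefficients. Writing the finite sum over all of Z makes these shifts free of boundary terms. *)
Lemma finite_jacobi_triple_product (q x : C) (n : nat) :
  q <> 0 -> (Cmod q < 1)%R -> x <> 0 ->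
  theta_prod q x n = CSeriesZ (fun j => jtp_coeff q n j * theta_term q x j).
Proof.
  intros Hq Hq1 Hx. induction n as [|n IH].
  - pose proof (Zsummable_jtp q x 0 Hq Hq1 Hx) as [Hs _].
    assert (Hz : forall j, (j <> 0)%Z -> jtp_coeff q 0 j = 0).
    { intros j Hj. unfold jtp_coeff, inv_qfact.
      destruct (Z_lt_dec (Z.of_nat 0 + j) 0); [ring|].
      destruct (Z_lt_dec (Z.of_nat 0 - j) 0); [ring|]. lia. }
    unfold CSeriesZ. rewrite (CSeries_incr_1 _ Hs).
    rewrite (CSeries_ext (fun n => jtp_coeff q 0 (Z.of_nat (S n)) * theta_term q x (Z.of_nat (S n)))
      (fun _ => 0)) by (intros k; rewrite Hz by lia; ring).
    rewrite (CSeries_ext (fun n => jtp_coeff q 0 (- Z.of_nat (S n)) * theta_term q x (- Z.of_nat (S n)))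
      (fun _ => 0)) by (intros k; rewrite Hz by lia; ring).
    rewrite CSeries_zero. unfold theta_prod, jtp_coeff, inv_qfact, theta_term, qfact. simpl. field.
  - set (t := theta_term q x) in *.
    set (c := jtp_coeff q n) in *.
    pose proof (Zsummable_jtp q x n Hq Hq1 Hx) as Hs. fold t c in Hs.
    assert (Ht : forall j, t (j + 1)%Z = x * Cpowz q j * t j)
      by (intros j; now apply theta_term_succ).
    assert (Hpn : forall j, Cpowz q j <> 0) by (intros j; now apply Cpowz_neq_0).
    (* [u2] and [u3] are the contributions of [x q^n] and [q^(n+1)/x]; [E2] and [E3] undo their
       index shifts. *)
    set (u2 := fun j => q ^ n * Cpowz q (1 - j) * c (j - 1)%Z * t j).
    set (u3 := fun j => q ^ S n * Cpowz q j * c (j + 1)%Z * t j).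
    assert (E2 : forall j, u2 (j + 1)%Z = q ^ n * x * (c j * t j)).
    { intros j. unfold u2. rewrite Ht.
      replace (1 - (j + 1))%Z with (- j)%Z by lia. replace (j + 1 - 1)%Z with j by lia.
      rewrite Cpowz_opp by easy. field. apply Hpn. }
    assert (E3 : forall j, u3 j = q ^ S n / x * (c (j + 1)%Z * t (j + 1)%Z)).
    { intros j. unfold u3. rewrite Ht. field. easy. }
    assert (S2' : Zsummable (fun j => q ^ n * x * (c j * t j))) by now apply Zsummable_scal.
    assert (S2 : Zsummable u2).
    { apply Zsummable_succ. revert S2'. apply Zsummable_ext. intros j. now rewrite E2. }
    assert (Hsu : Zsummable (fun j => c (j + 1)%Z * t (j + 1)%Z))
      by exact (proj2 (Zsummable_succ (fun j => c j * t j)) Hs).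
    assert (S3 : Zsummable u3).
    { apply (Zsummable_ext (fun j => q ^ S n / x * (c (j + 1)%Z * t (j + 1)%Z))).
      - intros j. now rewrite E3.
      - now apply Zsummable_scal. }
    assert (S1 : Zsummable (fun j => (1 + q ^ (2 * n + 1)) * (c j * t j)))
      by now apply Zsummable_scal.
    rewrite (CSeriesZ_ext _ (fun j => ((1 + q ^ (2 * n + 1)) * (c j * t j) + u2 j) + u3 j)).
    2:{ intros j. rewrite jtp_coeff_succ by easy. unfold u2, u3. fold c. ring. }
    rewrite CSeriesZ_plus, CSeriesZ_plus, CSeriesZ_scal by (auto using Zsummable_plus).
    rewrite <- (CSeriesZ_succ u2 S2), (CSeriesZ_ext _ _ E2), (CSeriesZ_ext u3 _ E3).
    rewrite !CSeriesZ_scal by auto.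
    rewrite (CSeriesZ_succ (fun j => c j * t j) Hs), <- IH.
    unfold theta_prod. simpl Cprod. fold (theta_prod q x n).
    replace (q ^ (2 * n + 1)) with (q ^ n * q ^ n * q)
      by (replace (2 * n + 1)%nat with (n + n + 1)%nat by lia; rewrite !Cpow_add_r; simpl; ring).
    simpl. field. easy.
Qed.

(** * Lower bounds for theta *)

(** Consecutive values differ by [qfact q m * q^(m+1)], so the differences telescope into a
    geometric sum. *)
Lemma qfact_close (q : C) (B : R) : (Cmod q < 1)%R ->
  (forall n, Cmod (qfact q n) <= B)%R -> forall n i,
  (Cmod (qfact q (n + i) - qfact q n) <= B / (1 - Cmod q) * Cmod q ^ n)%R.
Proof.
  intros Hq1 HB n i. pose proof (Cmod_ge_0 q) as Hq0.
  set (rho := Cmod q) in *.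
  assert (HB0 : (0 <= B)%R) by (eapply Rle_trans; [apply Cmod_ge_0|apply (HB 0%nat)]).
  assert (Hn : (0 <= rho ^ n)%R) by now apply pow_le.
  assert (H : (Cmod (qfact q (n + i) - qfact q n)
    <= B * rho ^ n * (/ (1 - rho) - rho ^ i / (1 - rho)))%R).
  { induction i as [|i IH].
    - rewrite Nat.add_0_r. replace (qfact q n - qfact q n) with (RtoC 0) by ring.
      rewrite Cmod_0. right. simpl. field. lra.
    - rewrite Nat.add_succ_r.
      replace (qfact q (S (n + i)) - qfact q n)
        with ((qfact q (n + i) - qfact q n) + - (qfact q (n + i) * q ^ S (n + i)))
        by (unfold qfact; simpl; ring).
      eapply Rle_trans; [apply Cmod_triangle|].
      rewrite Cmod_opp, Cmod_mult, Cmod_pow. fold rho.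
      replace (B * rho ^ n * (/ (1 - rho) - rho ^ S i / (1 - rho)))%R
        with (B * rho ^ n * (/ (1 - rho) - rho ^ i / (1 - rho)) + B * (rho ^ n * rho ^ i))%R
        by (simpl; field; lra).
      apply Rplus_le_compat; [exact IH|].
      apply Rmult_le_compat; [apply Cmod_ge_0|now apply pow_le|apply HB|].
      rewrite <- pow_add. simpl.
      assert (0 <= rho ^ (n + i))%R by now apply pow_le. nra. }
  eapply Rle_trans; [apply H|].
  pose proof (geom_partial_le rho i ltac:(lra)) as Hg.
  replace (B / (1 - rho) * rho ^ n)%R with (B * rho ^ n * / (1 - rho))%R by (field; lra).
  apply Rmult_le_compat_l; [now apply Rmult_le_pos|]. apply Hg.
Qed.

Lemma Cmod_Cpowz_add_nat (q : C) (n : nat) (j : Z) : q <> 0 ->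
  (Cmod (Cpowz q (Z.of_nat n + j)) = Cmod q ^ n * Cmod (Cpowz q j))%R.
Proof. intros Hq. now rewrite Cpowz_add, Cmod_mult, Cpowz_of_nat, Cmod_pow. Qed.

(** The accuracy is governed by the smaller of the indices [n] and [n + j]: it is [|q|^n] for
    [j >= 0] and [|q|^(n+j) = |q|^n |q^j|] for [j < 0]. The weight [1 + |q^j|] covers both. *)
Lemma inv_qfact_close (q : C) (B : R) : q <> 0 -> (Cmod q < 1)%R -> (1 <= B)%R ->
  (forall n, (/ B <= Cmod (qfact q n) <= B)%R) -> forall n j,
  (Cmod (qfact q n * inv_qfact q (Z.of_nat n + j) - 1)
   <= B / (1 - Cmod q) * B * (Cmod q ^ n * (1 + Cmod (Cpowz q j))))%R.
Proof.
  intros Hq Hq1 HB1 HB n j.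
  assert (Hq0 : (0 < Cmod q)%R) by now apply Cmod_gt_0.
  assert (HC : (1 <= B / (1 - Cmod q))%R) by (apply Rle_div_r; lra).
  assert (HCB : (0 <= B / (1 - Cmod q) * B)%R) by (apply Rmult_le_pos; lra).
  assert (Hpn : (0 < Cmod q ^ n)%R) by now apply pow_lt.
  pose proof (Cmod_ge_0 (Cpowz q j)) as Hj0.
  pose proof (inv_qfact_bound q B HB1 HB) as HH.
  pose proof (qfact_close q B Hq1 (fun n => proj2 (HB n))) as Hcl.
  pose proof (Cmod_Cpowz_add_nat q n j Hq) as Epow.
  assert (Hgen : forall m k D, (0 <= D)%R ->
    (Cmod (qfact q m - qfact q k) <= D)%R ->
    (Cmod (qfact q m * inv_qfact q (Z.of_nat k) - 1) <= D * B)%R).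
  { intros m k D HD H.
    replace (qfact q m * inv_qfact q (Z.of_nat k) - 1)
      with ((qfact q m - qfact q k) * inv_qfact q (Z.of_nat k)).
    - rewrite Cmod_mult. apply Rmult_le_compat; auto using Cmod_ge_0.
    - unfold inv_qfact. destruct (Z_lt_dec (Z.of_nat k) 0); [lia|].
      rewrite Nat2Z.id. field. now apply qfact_neq_0. }
  destruct (Z_lt_dec (Z.of_nat n + j) 0) as [Hneg|Hpos].
  (* Here the default 0 makes the error equal to 1, which is absorbed because
     [|q|^n |q^j| = |q^(n+j)| >= 1]. *)
  - unfold inv_qfact. destruct (Z_lt_dec (Z.of_nat n + j) 0); [|lia].
    replace (qfact q n * 0 - 1) with (- (1)) by ring. rewrite Cmod_opp, Cmod_1.
    assert (H1 : (1 <= Cmod (Cpowz q (Z.of_nat n + j)))%R).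
    { replace (Z.of_nat n + j)%Z with (- Z.of_nat (Z.to_nat (- (Z.of_nat n + j))))%Z by lia.
      rewrite Cpowz_opp_of_nat, Cmod_inv, Cmod_pow by now apply Cpow_nz.
      set (k := Z.to_nat _).
      assert (Hk : (0 < Cmod q ^ k <= 1)%R).
      { split; [now apply pow_lt|]. rewrite <- (pow1 k). apply pow_incr. lra. }
      rewrite <- Rinv_1. apply Rinv_le_contravar; lra. }
    rewrite Epow in H1.
    assert (1 <= B / (1 - Cmod q) * B)%R by nra. nra.
  - destruct (Z.le_gt_cases 0 j) as [Hj|Hj].
    + replace (Z.of_nat n + j)%Z with (Z.of_nat (n + Z.to_nat j)) by lia.
      eapply Rle_trans.
      * apply (Hgen _ _ (B / (1 - Cmod q) * Cmod q ^ n)%R).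
        -- apply Rmult_le_pos; lra.
        -- rewrite Cmod_minus_sym. apply Hcl.
      * assert (0 <= B / (1 - Cmod q) * B * (Cmod q ^ n * Cmod (Cpowz q j)))%R.
        { apply Rmult_le_pos; [exact HCB|]. apply Rmult_le_pos; lra. }
        lra.
    + destruct (Z_of_nat_complete (Z.of_nat n + j) ltac:(lia)) as [m Em].
      assert (En : n = (m + Z.to_nat (- j))%nat) by lia.
      rewrite Em in Epow |- *.
      rewrite Cpowz_of_nat, Cmod_pow in Epow.
      eapply Rle_trans.
      * apply (Hgen _ _ (B / (1 - Cmod q) * Cmod q ^ m)%R).
        -- apply Rmult_le_pos; [lra|]. apply pow_le. lra.
        -- rewrite En at 1. apply Hcl.
      * rewrite Epow.
        assert (0 <= B / (1 - Cmod q) * B * Cmod q ^ n)%R.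
        { apply Rmult_le_pos; [exact HCB|lra]. }
        lra.
Qed.

(** [S] is chosen before [K] and [a], so one constant serves a whole family of series dominated by
    multiples of [w]. *)
Lemma CSeriesZ_bound (w : Z -> R) :
  ex_series (fun n => w (Z.of_nat n)) -> ex_series (fun n => w (- Z.of_nat (S n))%Z) ->
  exists S : R, forall (K : R) (a : Z -> C),
    (forall n, Cmod (a n) <= K * w n)%R -> (Cmod (CSeriesZ a) <= K * S)%R.
Proof.
  intros H1 H2.
  exists (2 * Series (fun n => w (Z.of_nat n)) + 2 * Series (fun n => w (- Z.of_nat (S n))%Z))%R.
  intros K a H. unfold CSeriesZ.
  eapply Rle_trans; [apply Cmod_triangle|].
  rewrite Rmult_plus_distr_l.
  replace (K * (2 * Series (fun n => w (Z.of_nat n))))%R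
    with (2 * (K * Series (fun n => w (Z.of_nat n))))%R by ring.
  replace (K * (2 * Series (fun n => w (- Z.of_nat (S n))%Z)))%R
    with (2 * (K * Series (fun n => w (- Z.of_nat (S n))%Z)))%R by ring.
  rewrite <- (Series_scal_l K), <- (Series_scal_l K).
  apply Rplus_le_compat; apply Cmod_CSeries_le;
    try (intros n; apply H); now apply (@ex_series_scal_l R_AbsRing).
Qed.

(** After normalisation the j-th theta term carries the coefficient [e j * e (-j)], which differs
    from 1 by at most a constant times [|q|^n (1 + |q^j| + |q^(-j)|)]. This weight is summable
    against the theta terms, since [q^j] and [q^(-j)] turn them into the theta terms at [x q] and
    [x / q]. *)
Lemma theta_prod_limit (q x : C) : q <> 0 -> (Cmod q < 1)%R -> x <> 0 ->
  exists D : R, forall n,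
    (Cmod (theta_prod q x n * (qfact q n * qfact q n / qfact q (2 * n)) - theta q x)
     <= D * Cmod q ^ n)%R.
Proof.
  intros Hq Hq1 Hx. destruct (qfact_bounds q Hq1) as [B [HB1 HB]].
  assert (Hq0 : (0 < Cmod q)%R) by now apply Cmod_gt_0.
  set (C0 := (B / (1 - Cmod q) * B)%R).
  assert (HC : (1 <= B / (1 - Cmod q))%R) by (apply Rle_div_r; lra).
  assert (HC0 : (1 <= C0)%R) by (unfold C0; nra).
  pose proof (inv_qfact_close q B Hq Hq1 HB1 HB) as Hcl. fold C0 in Hcl.
  pose proof (inv_qfact_bound q B HB1 HB) as HH.
  set (t := theta_term q x).
  assert (Ht : Zsummable t) by now apply Zsummable_theta_term.
  set (w := fun j => ((1 + Cmod (Cpowz q j) + Cmod (Cpowz q (- j))) * Cmod (t j))%R).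
  assert (Hw : Zsummable (fun j => RtoC (w j))).
  { assert (Hx1 : Zsummable (theta_term q (x * q)))
      by (apply Zsummable_theta_term; auto using Cmult_neq_0).
    assert (Hxi : Zsummable (theta_term q (x * / q))).
    { apply Zsummable_theta_term; auto. apply Cmult_neq_0; auto using Cinv_neq_0. }
    apply (Zsummable_ext (fun j => RtoC (Cmod (t j)) + RtoC (Cmod (theta_term q (x * q) j))
                           + RtoC (Cmod (theta_term q (x * / q) j)))).
    - intros j. rewrite theta_term_mult by easy.
      replace (theta_term q (x * / q) j) with (Cpowz q (- j) * t j).
      + unfold w. rewrite !Cmod_mult. fold (t j). rewrite <- !RtoC_plus. f_equal. ring.
      + unfold t. replace x with (x * / q * q) at 1 by (field; easy).
        rewrite theta_term_mult by (auto using Cmult_neq_0, Cinv_neq_0).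
        rewrite Cpowz_opp by easy. field. now apply Cpowz_neq_0.
    - assert (Habs : forall a, Zsummable a -> Zsummable (fun j => RtoC (Cmod (a j)))).
      { intros a. apply (Zsummable_le _ _ 1). intros j.
        rewrite Cmod_R, Rabs_pos_eq by apply Cmod_ge_0. lra. }
      apply Zsummable_plus; [apply Zsummable_plus|]; now apply Habs. }
  assert (Hw0 : forall j, (0 <= w j)%R).
  { intros j. apply Rmult_le_pos; [|apply Cmod_ge_0].
    pose proof (Cmod_ge_0 (Cpowz q j)). pose proof (Cmod_ge_0 (Cpowz q (- j))). lra. }
  destruct Hw as [Hw1 Hw2].
  destruct (CSeriesZ_bound w) as [S HS].
  { revert Hw1. apply ex_series_ext. intros n. rewrite Cmod_R. now apply Rabs_pos_eq. }
  { revert Hw2. apply ex_series_ext. intros n. rewrite Cmod_R. now apply Rabs_pos_eq. }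
  exists (C0 * (B * B + 1) * S)%R. intros n.
  set (g := qfact q n).
  set (e := fun j => g * inv_qfact q (Z.of_nat n + j)).
  assert (Hg2 : qfact q (2 * n) <> 0) by now apply qfact_neq_0.
  assert (Es : theta_prod q x n * (g * g / qfact q (2 * n)) - theta q x
    = CSeriesZ (fun j => (e j * e (- j)%Z - 1) * t j)).
  { rewrite finite_jacobi_triple_product by easy.
    pose proof (Zsummable_jtp q x n Hq Hq1 Hx) as Hj. fold t in Hj.
    change (theta q x) with (CSeriesZ t). fold t.
    rewrite (CSeriesZ_ext (fun j => (e j * e (- j)%Z - 1) * t j)
      (fun j => g * g / qfact q (2 * n) * (jtp_coeff q n j * t j) + - (1) * t j)).
    - rewrite CSeriesZ_plus, !CSeriesZ_scal by auto using Zsummable_scal. ring.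
    - intros j. unfold jtp_coeff, e. change (Z.of_nat n + - j)%Z with (Z.of_nat n - j)%Z.
      field. easy. }
  rewrite Es.
  replace (C0 * (B * B + 1) * S * Cmod q ^ n)%R
    with (C0 * (B * B + 1) * Cmod q ^ n * S)%R by ring.
  apply HS. intros j. rewrite Cmod_mult. unfold w. rewrite <- Rmult_assoc.
  apply Rmult_le_compat_r; [apply Cmod_ge_0|].
  replace (e j * e (- j)%Z - 1) with ((e j - 1) * e (- j)%Z + (e (- j)%Z - 1)) by ring.
  eapply Rle_trans; [apply Cmod_triangle|]. rewrite Cmod_mult.
  pose proof (Hcl n j) as H1. pose proof (Hcl n (- j)%Z) as H2.
  fold g in H1, H2. fold (e j) in H1. fold (e (- j)%Z) in H2.
  assert (H3 : (Cmod (e (- j)%Z) <= B * B)%R).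
  { unfold e. rewrite Cmod_mult. apply Rmult_le_compat; auto using Cmod_ge_0. apply HB. }
  set (a := Cmod (Cpowz q j)) in *. set (b := Cmod (Cpowz q (- j))) in *.
  assert (Ha : (0 <= a)%R) by apply Cmod_ge_0.
  assert (Hb : (0 <= b)%R) by apply Cmod_ge_0.
  assert (Hp : (0 < Cmod q ^ n)%R) by now apply pow_lt.
  set (r := (Cmod q ^ n)%R) in *.
  assert (H4 : (Cmod (e j - 1) * Cmod (e (- j)%Z) <= C0 * (r * (1 + a)) * (B * B))%R).
  { apply Rmult_le_compat; auto using Cmod_ge_0. }
  assert (Hr : (0 <= C0 * r)%R) by (apply Rmult_le_pos; lra).
  assert (HBB : (0 <= B * B)%R) by nra.
  assert (H5 : (C0 * (r * (1 + a)) * (B * B) <= C0 * r * (1 + a + b) * (B * B))%R).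
  { apply Rmult_le_compat_r; [easy|]. rewrite <- Rmult_assoc.
    apply Rmult_le_compat_l; [easy|lra]. }
  assert (H6 : (C0 * (r * (1 + b)) <= C0 * r * (1 + a + b))%R).
  { rewrite <- Rmult_assoc. apply Rmult_le_compat_l; [easy|lra]. }
  lra.
Qed.

(** The normalising quotient has modulus at least [c = B^(-3)] for all [n], and the error [D |q|^n]
    tends to 0, so a lower bound on late partial products survives in the limit. [c] depends on [q]
    only, whereas [D] may depend on [x]. *)
Lemma theta_lower (q : C) : q <> 0 -> (Cmod q < 1)%R ->
  exists c : R, (0 < c)%R /\ forall (x : C) (delta : R) (N : nat), x <> 0 ->
    (forall n, (N <= n)%nat -> (delta <= Cmod (theta_prod q x n))%R) ->
    (c * delta <= Cmod (theta q x))%R.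
Proof.
  intros Hq Hq1. destruct (qfact_bounds q Hq1) as [B [HB1 HB]].
  assert (Hi : (0 < / B)%R) by (apply Rinv_0_lt_compat; lra).
  exists (/ B * / B * / B)%R. split; [repeat apply Rmult_lt_0_compat; lra|].
  intros x delta N Hx HN.
  destruct (theta_prod_limit q x Hq Hq1 Hx) as [D HD].
  set (c := (/ B * / B * / B)%R).
  assert (Hc : (0 < c)%R) by (repeat apply Rmult_lt_0_compat; lra).
  assert (H : forall n, (N <= n)%nat -> (c * delta <= Cmod (theta q x) + D * Cmod q ^ n)%R).
  { intros n Hn. specialize (HD n). specialize (HN n Hn).
    set (P := theta_prod q x n) in *.
    set (s := qfact q n * qfact q n / qfact q (2 * n)) in *.
    assert (Hs : (c <= Cmod s)%R).
    { unfold s. rewrite Cmod_div, Cmod_mult by now apply qfact_neq_0.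
      unfold c, Rdiv. pose proof (HB n). pose proof (HB (2 * n)%nat) as H2.
      apply Rmult_le_compat; try (apply Rmult_le_compat); try lra; try nra.
      apply Rinv_le_contravar; lra. }
    pose proof (Cmod_triangle_inv (P * s) (theta q x)) as Ht. rewrite Cmod_mult in Ht.
    pose proof (Cmod_ge_0 P).
    assert (c * delta <= Cmod P * Cmod s)%R.
    { apply Rle_trans with (c * Cmod P)%R; nra. }
    lra. }
  destruct (Rle_lt_dec (c * delta) (Cmod (theta q x))) as [Hle|Hlt]; [easy|exfalso].
  set (eps := (c * delta - Cmod (theta q x))%R).
  assert (He : (0 < eps / (Rabs D + 1))%R).
  { apply Rdiv_lt_0_compat; [unfold eps; lra|]. pose proof (Rabs_pos D). lra. }
  assert (Hrho : (Rabs (Cmod q) < 1)%R) by (rewrite Rabs_pos_eq; [easy|apply Cmod_ge_0]).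
  destruct (pow_lt_1_zero (Cmod q) Hrho _ He) as [M HM].
  specialize (HM (N + M)%nat ltac:(lia)). specialize (H (N + M)%nat ltac:(lia)).
  assert (Hp : (0 <= Cmod q ^ (N + M))%R) by apply pow_le, Cmod_ge_0.
  rewrite Rabs_pos_eq in HM by easy.
  pose proof (Rabs_pos D). pose proof (Rle_abs D).
  apply Rlt_div_r in HM; [|lra].
  unfold eps in HM. nra.
Qed.

Lemma Cprod_mult (f g : nat -> C) (n : nat) :
  Cprod (fun k => f k * g k) n = Cprod f n * Cprod g n.
Proof. induction n as [|n IH]; simpl; [ring|]. rewrite IH. ring. Qed.

(** With [M |q|^N <= 1/2], both families of factors beyond [N] are covered by [Cprod_bounds] with
    [tau = 1/2]. Each contributes at least [s] whatever its length, so only the first [N] pairs of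
    factors can make theta small on the annulus. *)
Lemma theta_lower_annulus (q : C) (M : R) : q <> 0 -> (Cmod q < 1)%R ->
  exists (N : nat) (c : R), (0 < c)%R /\ forall x : C, x <> 0 ->
    (Cmod x <= M)%R -> (Cmod (/ x) <= M)%R ->
    (c * Cmod (theta_prod q x N) <= Cmod (theta q x))%R.
Proof.
  intros Hq Hq1. destruct (theta_lower q Hq Hq1) as [c0 [Hc0 Hlow]].
  pose proof (Cmod_ge_0 q) as Hq0.
  set (s := exp (- (1 / 2 / (1 - 1 / 2) * / (1 - Cmod q)))).
  assert (Hs : (0 < s)%R) by apply exp_pos.
  assert (HN : exists N, (M * Cmod q ^ N <= 1 / 2)%R).
  { assert (Hrho : (Rabs (Cmod q) < 1)%R) by (rewrite Rabs_pos_eq; lra).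
    assert (He : (0 < 1 / 2 / (Rabs M + 1))%R).
    { apply Rdiv_lt_0_compat; [lra|]. pose proof (Rabs_pos M). lra. }
    destruct (pow_lt_1_zero (Cmod q) Hrho _ He) as [N HN]. exists N.
    specialize (HN N (le_n N)).
    rewrite Rabs_pos_eq in HN by now apply pow_le.
    pose proof (Rabs_pos M). pose proof (Rle_abs M).
    apply Rlt_div_r in HN; [|lra].
    assert (0 <= Cmod q ^ N)%R by now apply pow_le. nra. }
  destruct HN as [N HN]. exists N, (c0 * (s * s))%R.
  split; [repeat apply Rmult_lt_0_compat; easy|].
  intros x Hx HxM HxM'. rewrite Rmult_assoc. apply (Hlow x _ N Hx).
  intros n Hn. replace n with (N + (n - N))%nat by lia. set (i := (n - N)%nat).
  unfold theta_prod. rewrite Cprod_add. fold (theta_prod q x N).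
  rewrite (Cprod_mult (fun k => 1 + x * q ^ (N + k)) (fun k => 1 + q ^ S (N + k) / x)).
  rewrite !Cmod_mult, Rmult_comm.
  apply Rmult_le_compat_l; [apply Cmod_ge_0|].
  assert (Hbd : forall y k, (Cmod y <= M)%R -> (Cmod (y * q ^ (N + k)) <= 1 / 2 * Cmod q ^ k)%R).
  { intros y k Hy. rewrite Cmod_mult, Cmod_pow, pow_add, <- Rmult_assoc.
    apply Rmult_le_compat_r; [now apply pow_le|].
    eapply Rle_trans; [|apply HN]. apply Rmult_le_compat_r; [now apply pow_le|easy]. }
  apply Rmult_le_compat; try lra.
  - apply (Cprod_bounds (fun k => x * q ^ (N + k))); [lra|lra|].
    intros k. now apply Hbd.
  - apply (Cprod_bounds (fun k => q ^ S (N + k) / x)); [lra|lra|].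
    intros k. replace (q ^ S (N + k) / x) with (q * (/ x * q ^ (N + k))) by (simpl; field; easy).
    rewrite Cmod_mult. pose proof (Hbd (/ x) k HxM').
    pose proof (Cmod_ge_0 (/ x * q ^ (N + k))). nra.
Qed.

(** A zero of [1 + x q^k] gives [- x = q^(-k)], a zero of [1 + q^(k+1)/x] gives [- x = q^(k+1)]; any
    [x] lies in some annulus. *)
Lemma theta_neq_0 (q x : C) : q <> 0 -> (Cmod q < 1)%R -> x <> 0 ->
  (forall n : Z, - x <> Cpowz q n) -> theta q x <> 0.
Proof.
  intros Hq Hq1 Hx H.
  destruct (theta_lower_annulus q (Rmax (Cmod x) (Cmod (/ x))) Hq Hq1) as [N [c [Hc Hl]]].
  apply Cmod_gt_0.
  eapply Rlt_le_trans; [|apply Hl; [easy|apply Rmax_l|apply Rmax_r]].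
  apply Rmult_lt_0_compat; [easy|]. apply Cmod_gt_0.
  unfold theta_prod. clear Hl. induction N as [|N IH]; simpl Cprod.
  - apply RtoC_neq. lra.
  - assert (Hqn := Cpow_nz q N Hq).
    apply Cmult_neq_0; [easy|]. apply Cmult_neq_0; intros E.
    + apply (H (- Z.of_nat N)%Z). rewrite Cpowz_opp_of_nat.
      apply (Cmult_reg_r _ _ (q ^ N) Hqn).
      replace (- x * q ^ N) with (1 - (1 + x * q ^ N)) by ring. rewrite E. field. easy.
    + apply (H (Z.of_nat (S N))). rewrite Cpowz_of_nat.
      replace (- x) with (q ^ S N - (1 + q ^ S N / x) * x) by (simpl; field; easy).
      simpl in *. rewrite E. ring.
Qed.

(** A lower bound in place of an order of vanishing: it is stable under products, excludes zeros on
    a deleted neighbourhood, and for a holomorphic [f] makes the reciprocal meromorphic. *)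
Definition finite_order_at (f : C -> C) (u0 : C) : Prop :=
  exists (c : R) (n : nat), (0 < c)%R /\
    locally u0 (fun u => (c * Cmod (u - u0) ^ n <= Cmod (f u))%R).

Lemma finite_order_at_mult (f g : C -> C) (u0 : C) :
  finite_order_at f u0 -> finite_order_at g u0 -> finite_order_at (fun u => f u * g u) u0.
Proof.
  intros [c [n [Hc Hf]]] [d [k [Hd Hg]]]. exists (c * d)%R, (n + k)%nat.
  split; [now apply Rmult_lt_0_compat|].
  generalize (filter_and _ _ Hf Hg). apply filter_imp. intros u [H1 H2].
  rewrite Cmod_mult, pow_add.
  replace (c * d * (Cmod (u - u0) ^ n * Cmod (u - u0) ^ k))%R
    with ((c * Cmod (u - u0) ^ n) * (d * Cmod (u - u0) ^ k))%R by ring.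
  apply Rmult_le_compat; auto; apply Rmult_le_pos; try lra; apply pow_le, Cmod_ge_0.
Qed.

Lemma finite_order_at_neq_0 (f : C -> C) (u0 : C) :
  finite_order_at f u0 -> locally' u0 (fun u => f u <> 0).
Proof.
  intros [c [n [Hc Hf]]]. unfold locally', within. revert Hf. apply filter_imp.
  intros u H Hu. apply Cmod_gt_0. eapply Rlt_le_trans; [|apply H].
  apply Rmult_lt_0_compat; [easy|]. apply pow_lt, Cmod_gt_0.
  intros E. apply Hu. change (@eq C u u0).
  replace u with (u - u0 + u0) by ring. rewrite E. ring.
Qed.

Lemma finite_order_at_inv (f : C -> C) (u0 : C) :
  holomorphic_near f u0 -> finite_order_at f u0 -> meromorphic_at (fun u => / f u) u0.
Proof.
  intros Hf [c [n [Hc H]]]. now apply (meromorphic_at_inv f u0 n c).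
Qed.

Lemma finite_order_at_one_minus_Cexp (p u0 : C) :
  finite_order_at (fun u => 1 - p * Cexp u) u0.
Proof.
  destruct (one_minus_Cexp_lower p u0) as [c [Hc H]]. exists c, 1%nat. split; [easy|].
  revert H. apply filter_imp. intros u H. now rewrite pow_1.
Qed.

Lemma finite_order_at_one_minus_Cexp_opp (p u0 : C) :
  finite_order_at (fun u => 1 - p * Cexp (- u)) u0.
Proof.
  destruct (finite_order_at_one_minus_Cexp p (- u0)) as [c [n [Hc H]]].
  exists c, n. split; [easy|].
  apply locally_Cmod in H. destruct H as [r [Hr H]].
  apply locally_Cmod. exists r. split; [easy|]. intros u Hu.
  assert (E : Cmod (- u - - u0) = Cmod (u - u0))
    by (rewrite <- Cmod_opp; f_equal; ring).
  rewrite <- E. apply H. now rewrite E.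
Qed.

(** In the variable [u] the finitely many decisive factors have the form [1 - p' e^u] or
    [1 - p' e^(-u)], each of finite order at every point. *)
Lemma finite_order_at_theta (q p u0 : C) : q <> 0 -> (Cmod q < 1)%R -> p <> 0 ->
  finite_order_at (fun u => theta q (- (Cexp u * p))) u0.
Proof.
  intros Hq Hq1 Hp.
  set (X := fun u => - (Cexp u * p)).
  assert (HX : forall u, X u <> 0).
  { intros u. apply Copp_neq_0, Cmult_neq_0; [apply Cexp_neq_0|easy]. }
  assert (HdX : Cdiff X u0).
  { apply Cdiff_opp, Cdiff_mult; [apply Cdiff_Cexp|apply Cdiff_const]. }
  assert (HX0 : (0 < Cmod (X u0))%R) by apply Cmod_gt_0, HX.
  set (m := Cmod (X u0)) in *.
  (* Near [u0] one has [m/2 <= |X u| <= 2m], so this radius bounds both [|X u|] and its inverse. *)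
  destruct (theta_lower_annulus q (2 * m + 2 / m) Hq Hq1) as [N [c [Hc Hl]]].
  assert (HP : finite_order_at (fun u => theta_prod q (X u) N) u0).
  { clear Hl. unfold theta_prod. induction N as [|N IH]; simpl Cprod.
    - exists 1%R, 0%nat. split; [lra|]. apply filter_forall. intros u.
      rewrite Cmod_1. simpl. lra.
    - apply finite_order_at_mult; [exact IH|]. apply finite_order_at_mult.
      + destruct (finite_order_at_one_minus_Cexp (p * q ^ N) u0) as [d [k [Hd H]]].
        exists d, k. split; [easy|]. revert H. apply filter_imp. intros u H.
        eapply Rle_trans; [apply H|]. right. f_equal. unfold X. ring.
      + destruct (finite_order_at_one_minus_Cexp_opp (q ^ S N / p) u0) as [d [k [Hd H]]].
        exists d, k. split; [easy|]. revert H. apply filter_imp. intros u H.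
        eapply Rle_trans; [apply H|]. right. f_equal. unfold X.
        rewrite Cexp_opp. simpl. field. split; [easy|apply Cexp_neq_0]. }
  destruct HP as [d [n [Hd HP]]].
  exists (c * d)%R, n. split; [now apply Rmult_lt_0_compat|].
  pose proof (Cdiff_near X u0 (m / 2) HdX ltac:(lra)) as Hn.
  generalize (filter_and _ _ HP Hn). apply filter_imp. intros u [H1 H2].
  fold (X u). rewrite Rmult_assoc.
  apply Rle_trans with (c * Cmod (theta_prod q (X u) N))%R.
  - apply Rmult_le_compat_l; [lra|exact H1].
  - assert (Hu : (m / 2 <= Cmod (X u) <= 2 * m)%R).
    { pose proof (Cmod_triangle_inv (X u) (X u0)) as Ha.
      pose proof (Cmod_triangle_inv (X u0) (X u)) as Hb.
      rewrite Cmod_minus_sym in Hb. fold m in Ha, Hb. split; lra. }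
    assert (Hm2 : (0 < 2 / m)%R) by (apply Rdiv_lt_0_compat; lra).
    apply Hl; [apply HX|lra|].
    rewrite Cmod_inv by apply HX.
    apply Rle_trans with (/ (m / 2))%R; [apply Rinv_le_contravar; lra|].
    replace (/ (m / 2))%R with (2 / m)%R by (field; lra). lra.
Qed.

Lemma Cdiff_theta_Cexp (q p u : C) : q <> 0 -> (Cmod q < 1)%R -> p <> 0 ->
  Cdiff (fun u => theta q (- (Cexp u * p))) u.
Proof.
  intros Hq Hq1 Hp. apply (Cdiff_comp (theta q) (fun u => - (Cexp u * p))).
  - apply Cdiff_theta; auto. apply Copp_neq_0, Cmult_neq_0; [apply Cexp_neq_0|easy].
  - apply Cdiff_opp, Cdiff_mult; [apply Cdiff_Cexp|apply Cdiff_const].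
Qed.

(** * Appell series and the solutions *)

(** Only the first [N] terms may have a pole near [u0]. The induction peels them off one by one,
    each a constant over a denominator of finite order, until the uniform bound makes the remaining
    series holomorphic. *)
Lemma partial_fractions_meromorphic (N : nat) (b P : nat -> C) (p u0 : C) (c r : R) :
  (0 < r)%R -> (0 < c)%R -> Csummable b ->
  (forall n z, (N <= n)%nat -> (Cmod (z - Cexp u0 * p) < r)%R ->
     (c * (1 + Cmod (P n)) <= Cmod (1 - z * P n))%R) ->
  meromorphic_at (fun u => CSeries (fun n => b n / (1 - Cexp u * p * P n))) u0.
Proof.
  intros Hr Hc. set (X := fun u => Cexp u * p).
  assert (HdX : forall u, Cdiff X u).
  { intros u. apply Cdiff_mult; [apply Cdiff_Cexp|apply Cdiff_const]. }
  pose proof (Cdiff_near X u0 r (HdX u0) Hr) as HX.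
  revert b P. induction N as [|N IH]; intros b P Hb H.
  - apply meromorphic_at_holomorphic. unfold holomorphic_near. revert HX.
    apply filter_imp. intros u Hu.
    apply (Cdiff_comp (fun z => CSeries (fun n => b n / (1 - z * P n))) X); [|apply HdX].
    (* The disc of this radius about [X u] lies in the given disc about [X u0]: differentiability is
       required at all points near [u0]. *)
    apply (partial_fractions_Cdiff b P (X u) c (r - Cmod (X u - X u0))); [lra|easy|easy|].
    intros n z Hz. apply H; [lia|]. fold (X u0).
    replace (z - X u0) with ((z - X u) + (X u - X u0)) by ring.
    eapply Rle_lt_trans; [apply Cmod_triangle|]. lra.
  - apply (meromorphic_at_ext (fun u => b 0%nat * / (1 - Cexp u * p * P 0%nat)
      + CSeries (fun n => b (S n) / (1 - Cexp u * p * P (S n))))).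
    + apply locally_locally'. revert HX. apply filter_imp. intros u Hu. symmetry.
      apply (CSeries_incr_1 (fun n => b n / (1 - Cexp u * p * P n))).
      (* Early denominators may be small or zero, so the terms are compared from index [S N] on. *)
      apply (Csummable_eventually_le _ (fun n => / c * Cmod (b n))%R (S N)).
      * intros n Hn. pose proof (H n (X u) Hn Hu) as Hl. fold (X u).
        pose proof (Cmod_ge_0 (P n)).
        assert (Hcl : (c <= Cmod (1 - X u * P n))%R) by nra.
        rewrite Cmod_div by (apply Cmod_gt_0; lra).
        unfold Rdiv. rewrite Rmult_comm.
        apply Rmult_le_compat_r; [apply Cmod_ge_0|].
        apply Rinv_le_contravar; lra.
      * now apply (@ex_series_scal_l R_AbsRing).
    + apply meromorphic_at_plus.
      * apply meromorphic_at_mult; [apply meromorphic_const|].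
        apply finite_order_at_inv.
        -- unfold holomorphic_near. apply filter_forall. intros u.
           apply Cdiff_minus; [apply Cdiff_const|].
           apply Cdiff_mult; [apply HdX|apply Cdiff_const].
        -- destruct (finite_order_at_one_minus_Cexp (p * P 0%nat) u0) as [d [k [Hd Hk]]].
           exists d, k. split; [easy|]. revert Hk. apply filter_imp. intros u Hu.
           eapply Rle_trans; [apply Hu|]. right. f_equal. ring.
      * apply (IH (fun n => b (S n)) (fun n => P (S n))).
        -- unfold Csummable in *. now apply (proj1 (ex_series_incr_1 _)) in Hb.
        -- intros n z Hn. apply H. lia.
Qed.

(** For late nonnegative exponents [|x q^n| <= 1/2], so the modulus is at least
    [1/2 >= (1 + |q^n|)/4]. For negative ones put [t = |q^(-n-1)|]: then [t/M >= 2] and [|x| >= 1/M]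
    give [|x| t - 1 >= t/(2M) >= 1/4 + t/(4M)]. *)
Lemma one_minus_qpow_lower (q : C) (M : R) : q <> 0 -> (Cmod q < 1)%R -> (0 < M)%R ->
  exists (N : nat) (c : R), (0 < c)%R /\ forall x : C, x <> 0 ->
    (Cmod x <= M)%R -> (Cmod (/ x) <= M)%R -> forall n, (N <= n)%nat ->
    (c * (1 + Cmod (Cpowz q (Z.of_nat n))) <= Cmod (1 - x * Cpowz q (Z.of_nat n)))%R /\
    (c * (1 + Cmod (Cpowz q (- Z.of_nat (S n))))
       <= Cmod (1 - x * Cpowz q (- Z.of_nat (S n))))%R.
Proof.
  intros Hq Hq1 HM.
  assert (Hq0 : (0 < Cmod q)%R) by now apply Cmod_gt_0.
  assert (Hrho : (Rabs (Cmod q) < 1)%R) by (rewrite Rabs_pos_eq; lra).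
  assert (He : (0 < 1 / 2 / M)%R) by (apply Rdiv_lt_0_compat; lra).
  destruct (pow_lt_1_zero (Cmod q) Hrho _ He) as [N HN].
  assert (HN' : forall n, (N <= n)%nat -> (0 < Cmod q ^ n)%R /\ (Cmod q ^ n * M <= 1 / 2)%R).
  { intros n Hn. specialize (HN n Hn).
    assert (0 < Cmod q ^ n)%R by now apply pow_lt.
    rewrite Rabs_pos_eq in HN by lra. apply Rlt_div_r in HN; lra. }
  assert (HMi : (0 < / M)%R) by now apply Rinv_0_lt_compat.
  exists N, (Rmin (1 / 4) (/ M / 4)). split; [apply Rmin_pos; lra|].
  set (c := Rmin (1 / 4) (/ M / 4)).
  assert (Hc1 : (c <= 1 / 4)%R) by apply Rmin_l.
  assert (Hc2 : (c <= / M / 4)%R) by apply Rmin_r.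
  assert (Hc0 : (0 < c)%R) by (apply Rmin_pos; lra).
  intros x Hx Hx1 Hx2 n Hn. split.
  - rewrite Cpowz_of_nat, Cmod_pow. destruct (HN' n Hn) as [Hp Hb].
    pose proof (Cmod_triangle_inv 1 (x * q ^ n)) as Ht.
    rewrite Cmod_1, Cmod_mult, Cmod_pow in Ht.
    assert (Cmod q ^ n <= 1)%R by (rewrite <- (pow1 n); apply pow_incr; lra).
    nra.
  - set (t := Cmod (Cpowz q (- Z.of_nat (S n)))).
    assert (Et : (t * Cmod q ^ S n = 1)%R).
    { unfold t. rewrite Cpowz_opp_of_nat, Cmod_inv, Cmod_pow by now apply Cpow_nz.
      apply Rinv_l. apply pow_nonzero. lra. }
    destruct (HN' (S n) ltac:(lia)) as [Hp Hb].
    assert (Ht0 : (0 <= t)%R) by apply Cmod_ge_0.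
    assert (Htm : (2 * M <= t)%R) by nra.
    rewrite Cmod_inv in Hx2 by easy.
    assert (Hx0 : (0 < Cmod x)%R) by now apply Cmod_gt_0.
    assert (Hxm : (/ M <= Cmod x)%R).
    { rewrite <- (Rinv_inv (Cmod x)). apply Rinv_le_contravar; [|easy].
      now apply Rinv_0_lt_compat. }
    assert (HMM : (M * / M = 1)%R) by (apply Rinv_r; lra).
    assert (Hxt : (t * / M <= t * Cmod x)%R) by now apply Rmult_le_compat_l.
    assert (Hxt2 : (2 <= t * / M)%R).
    { apply Rle_trans with (2 * M * / M)%R; [lra|]. apply Rmult_le_compat_r; lra. }
    pose proof (Cmod_triangle_inv (x * Cpowz q (- Z.of_nat (S n))) 1) as Htr.
    rewrite Cmod_1, Cmod_mult in Htr. fold t in Htr.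
    rewrite (Cmod_minus_sym 1).
    assert (c * t <= / M / 4 * t)%R by now apply Rmult_le_compat_r.
    lra.
Qed.

Definition appell_coeff (q y : C) (n : Z) : C :=
  Cpowz (- RtoC 1) n * Cpowz y n * Cpowz q (n * (n + 1) / 2).

(** The Appell-Lerch series of [mu] without its prefactor. It depends on [x] and [y] themselves; the
    chosen logarithms enter [mu] only through elementary factors. *)
Definition appell (q x y : C) : C :=
  CSeriesZ (fun n => appell_coeff q y n / (RtoC 1 - x * Cpowz q n)).

Lemma appell_coeff_theta_term (q y : C) (n : Z) : q <> 0 -> y <> 0 ->
  appell_coeff q y n = Cpowz q n * theta_term q (- y) n.
Proof.
  intros Hq Hy. unfold appell_coeff, theta_term.
  replace (n * (n + 1))%Z with ((n + 1) * (n + 1 - 1))%Z by ring.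
  rewrite triangular_succ, (Cpowz_add q) by easy.
  replace (- y) with (- RtoC 1 * y) by ring.
  rewrite Cpowz_mult; [ring| |easy]. apply Copp_neq_0, RtoC_neq. lra.
Qed.

Lemma Zsummable_appell_coeff (q y : C) : q <> 0 -> (Cmod q < 1)%R -> y <> 0 ->
  Zsummable (appell_coeff q y).
Proof.
  intros Hq Hq1 Hy. apply (Zsummable_ext (theta_term q (- y * q))).
  - intros n. rewrite appell_coeff_theta_term by easy.
    apply theta_term_mult; [easy|now apply Copp_neq_0].
  - apply Zsummable_theta_term; auto. apply Cmult_neq_0; auto using Copp_neq_0.
Qed.

(** Outside a finite range of exponents the denominators are bounded below, so summability is
    inherited from the numerators. *)
Lemma Zsummable_appell (q x y : C) : q <> 0 -> (Cmod q < 1)%R -> x <> 0 -> y <> 0 ->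
  Zsummable (fun n => appell_coeff q y n / (1 - x * Cpowz q n)).
Proof.
  intros Hq Hq1 Hx Hy.
  set (M := Rmax (Cmod x) (Cmod (/ x))).
  assert (HM : (0 < M)%R).
  { eapply Rlt_le_trans; [|apply Rmax_l]. now apply Cmod_gt_0. }
  destruct (one_minus_qpow_lower q M Hq Hq1 HM) as [N [c [Hc H]]].
  specialize (H x Hx (Rmax_l _ _) (Rmax_r _ _)).
  destruct (Zsummable_appell_coeff q y Hq Hq1 Hy) as [H1 H2].
  assert (Hgen : forall b P : C, (c * (1 + Cmod P) <= Cmod (1 - x * P))%R ->
    (Cmod (b / (1 - x * P)) <= / c * Cmod b)%R).
  { intros b P Hl. pose proof (Cmod_ge_0 P).
    assert (Hcl : (c <= Cmod (1 - x * P))%R) by nra.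
    rewrite Cmod_div by (apply Cmod_gt_0; lra).
    unfold Rdiv. rewrite Rmult_comm.
    apply Rmult_le_compat_r; [apply Cmod_ge_0|]. apply Rinv_le_contravar; lra. }
  split.
  - apply (Csummable_eventually_le _ (fun n => / c * Cmod (appell_coeff q y (Z.of_nat n)))%R N).
    + intros n Hn. apply Hgen. now apply H.
    + now apply (@ex_series_scal_l R_AbsRing).
  - apply (Csummable_eventually_le _
      (fun n => / c * Cmod (appell_coeff q y (- Z.of_nat (S n))))%R N).
    + intros n Hn. apply Hgen. now apply H.
    + now apply (@ex_series_scal_l R_AbsRing).
Qed.

(** With [z = x q^(n+1)], the identity [1/(1 - z) = 1 + z/(1 - z)] splits the n-th term at [x q]
    into a theta term and an Appell term at [x], both of index [n + 1]; reindexing finishes. *)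
Lemma appell_shift (q x y : C) : q <> 0 -> (Cmod q < 1)%R -> x <> 0 -> y <> 0 ->
  (forall n : Z, 1 - x * Cpowz q n <> 0) ->
  appell q (x * q) y = - (theta q (- y) / y) - x / y * appell q x y.
Proof.
  intros Hq Hq1 Hx Hy H.
  assert (Hny : - y <> 0) by now apply Copp_neq_0.
  pose proof (Zsummable_theta_term q (- y) Hq Hq1 Hny) as Hs1.
  pose proof (Zsummable_appell q x y Hq Hq1 Hx Hy) as Hs2.
  set (g := fun n => - / y * theta_term q (- y) n
    + - (x / y) * (appell_coeff q y n / (1 - x * Cpowz q n))).
  assert (Hg : Zsummable g) by (apply Zsummable_plus; now apply Zsummable_scal).
  unfold appell.
  rewrite (CSeriesZ_ext _ (fun n => g (n + 1)%Z)).
  - rewrite (CSeriesZ_succ g Hg). unfold g.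
    rewrite CSeriesZ_plus, !CSeriesZ_scal by (auto using Zsummable_scal).
    change (theta q (- y)) with (CSeriesZ (theta_term q (- y))). field. easy.
  - intros n. unfold g. rewrite !appell_coeff_theta_term by easy.
    rewrite theta_term_succ by easy.
    pose proof (H (n + 1)%Z) as Hn. rewrite Cpowz_succ in * by easy.
    assert (Hpn : Cpowz q n <> 0) by now apply Cpowz_neq_0.
    replace (1 - x * q * Cpowz q n) with (1 - x * (Cpowz q n * q)) by ring.
    field. auto.
Qed.

Lemma locally'_forall_lt (u0 : C) (P : nat -> C -> Prop) (N : nat) :
  (forall k, (k < N)%nat -> locally' u0 (P k)) ->
  locally' u0 (fun u => forall k, (k < N)%nat -> P k u).
Proof.
  induction N as [|N IH]; intros H.
  - apply locally_locally', filter_forall. lia.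
  - assert (HN : locally' u0 (P N)) by (apply H; lia).
    assert (Hlt : forall k, (k < N)%nat -> locally' u0 (P k)) by (intros k Hk; apply H; lia).
    generalize (filter_and _ _ (IH Hlt) HN).
    apply filter_imp. intros u [H1 H2] k Hk.
    destruct (Nat.eq_dec k N) as [->|Hn]; [easy|]. apply H1. lia.
Qed.

Lemma Cexp_annulus (p u0 : C) : p <> 0 -> exists M : R, (0 < M)%R /\ exists r : R, (0 < r)%R /\
  forall z, (Cmod (z - Cexp u0 * p) < r)%R -> z <> 0 /\ (Cmod z <= M)%R /\ (Cmod (/ z) <= M)%R.
Proof.
  intros Hp. set (m := Cmod (Cexp u0 * p)).
  assert (Hm : (0 < m)%R).
  { apply Cmod_gt_0, Cmult_neq_0; [apply Cexp_neq_0|easy]. }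
  assert (Hm2 : (0 < 2 / m)%R) by (apply Rdiv_lt_0_compat; lra).
  exists (2 * m + 2 / m)%R. split; [lra|]. exists (m / 2)%R. split; [lra|].
  intros z Hz.
  pose proof (Cmod_triangle_inv z (Cexp u0 * p)) as Ha.
  pose proof (Cmod_triangle_inv (Cexp u0 * p) z) as Hb.
  rewrite Cmod_minus_sym in Hb. fold m in Ha, Hb.
  assert (Hz0 : z <> 0) by (apply Cmod_gt_0; lra).
  split; [easy|]. split; [lra|]. rewrite Cmod_inv by easy.
  apply Rle_trans with (/ (m / 2))%R; [apply Rinv_le_contravar; lra|].
  replace (/ (m / 2))%R with (2 / m)%R by (field; lra). lra.
Qed.

(** A filter only intersects finitely many conditions: large [|n|] is excluded uniformly on an
    annulus around [e^u0 p], and the finitely many exponents left each have isolated zeros. *)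
Lemma locally'_one_minus_qpow (q p u0 : C) : q <> 0 -> (Cmod q < 1)%R -> p <> 0 ->
  locally' u0 (fun u => forall n : Z, 1 - Cexp u * p * Cpowz q n <> 0).
Proof.
  intros Hq Hq1 Hp.
  destruct (Cexp_annulus p u0 Hp) as [M [HM [r [Hr HMr]]]].
  destruct (one_minus_qpow_lower q M Hq Hq1 HM) as [N [c [Hc H]]].
  assert (Hf : forall n : Z, locally' u0 (fun u => 1 - Cexp u * p * Cpowz q n <> 0)).
  { intros n. generalize (finite_order_at_neq_0 _ _
      (finite_order_at_one_minus_Cexp (p * Cpowz q n) u0)).
    apply filter_imp. intros u Hu E. apply Hu. rewrite <- E. ring. }
  assert (HX : locally' u0 (fun u => (Cmod (Cexp u * p - Cexp u0 * p) < r)%R)).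
  { apply locally_locally', (Cdiff_near (fun u => Cexp u * p) u0 r); [|easy].
    apply Cdiff_mult; [apply Cdiff_Cexp|apply Cdiff_const]. }
  pose proof (locally'_forall_lt u0 _ N (fun k _ => Hf (Z.of_nat k))) as H1.
  pose proof (locally'_forall_lt u0 _ N (fun k _ => Hf (- Z.of_nat (S k))%Z)) as H2.
  generalize (filter_and _ _ HX (filter_and _ _ H1 H2)). apply filter_imp.
  intros u [Hu [Hu1 Hu2]] n. destruct (HMr _ Hu) as [Hx0 [HxM HxM']].
  assert (Hgen : forall P : C, (c * (1 + Cmod P) <= Cmod (1 - Cexp u * p * P))%R ->
    1 - Cexp u * p * P <> 0).
  { intros P HP. apply Cmod_gt_0. pose proof (Cmod_ge_0 P). nra. }
  destruct (Z.le_gt_cases 0 n) as [Hn|Hn].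
  - rewrite <- (Z2Nat.id n Hn). destruct (Nat.lt_ge_cases (Z.to_nat n) N) as [Hl|Hl].
    + now apply Hu1.
    + apply Hgen. now apply (H _ Hx0 HxM HxM').
  - replace n with (- Z.of_nat (S (Z.to_nat (- n - 1))))%Z by lia.
    destruct (Nat.lt_ge_cases (Z.to_nat (- n - 1)) N) as [Hl|Hl].
    + now apply Hu2.
    + apply Hgen. now apply (H _ Hx0 HxM HxM').
Qed.

Lemma meromorphic_appell (q p y : C) : q <> 0 -> (Cmod q < 1)%R -> p <> 0 -> y <> 0 ->
  meromorphic (fun u => appell q (Cexp u * p) y).
Proof.
  intros Hq Hq1 Hp Hy u0.
  destruct (Cexp_annulus p u0 Hp) as [M [HM [r [Hr HMr]]]].
  destruct (one_minus_qpow_lower q M Hq Hq1 HM) as [N [c [Hc H]]].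
  destruct (Zsummable_appell_coeff q y Hq Hq1 Hy) as [H1 H2].
  apply (meromorphic_at_plus
    (fun u => CSeries (fun n => appell_coeff q y (Z.of_nat n)
       / (1 - Cexp u * p * Cpowz q (Z.of_nat n))))
    (fun u => CSeries (fun n => appell_coeff q y (- Z.of_nat (S n))
       / (1 - Cexp u * p * Cpowz q (- Z.of_nat (S n)))))).
  - apply (partial_fractions_meromorphic N _ (fun n => Cpowz q (Z.of_nat n)) p u0 c r Hr Hc H1).
    intros n z Hn Hz. destruct (HMr z Hz) as [Hx0 [HxM HxM']]. now apply (H z).
  - apply (partial_fractions_meromorphic N _ (fun n => Cpowz q (- Z.of_nat (S n))) p u0 c r Hr Hc H2).
    intros n z Hn Hz. destruct (HMr z Hz) as [Hx0 [HxM HxM']]. now apply (H z).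
Qed.

(** * The first-order factor applied to the solutions *)

Lemma inv_theta_first_order (L alpha : C) : (Cmod (Cexp L) < 1)%R ->
  let f := fun u => / theta (Cexp L) (- (Cexp u * Cexp (alpha * L))) in
  mero_eq (fun u => qshift L f u + Cexp u * Cexp (alpha * L) * f u) (fun _ => 0).
Proof.
  intros Hq1 f u0.
  assert (Hq : Cexp L <> 0) by apply Cexp_neq_0.
  assert (Hp : Cexp (alpha * L) <> 0) by apply Cexp_neq_0.
  generalize (finite_order_at_neq_0 _ _
    (finite_order_at_theta (Cexp L) (Cexp (alpha * L)) u0 Hq Hq1 Hp)).
  apply filter_imp. intros u Hu. unfold qshift, f.
  assert (Hx : - (Cexp u * Cexp (alpha * L)) <> 0).
  { apply Copp_neq_0, Cmult_neq_0; [apply Cexp_neq_0|easy]. }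
  replace (- (Cexp (u + L) * Cexp (alpha * L)))
    with (- (Cexp u * Cexp (alpha * L)) * Cexp L) by (rewrite Cexp_plus; ring).
  rewrite theta_shift by easy.
  pose proof (Cexp_neq_0 u). field. auto.
Qed.

(** In the shifted solution the theta value from [appell_shift] cancels the theta denominator of
    [mu]; what remains is [- q^a / y = - 1/lambda], with [y = lambda q^a], times the constant
    prefactor and [x^a]. *)
Definition mu_const (L loglambda alpha a : C) : C :=
  - (Ci * Cexp (- (L / RtoC 8)) * Cexp ((loglambda + loglambda + alpha * L + a * L) / RtoC 2)
     / Cexp loglambda).

Lemma mu_const_neq_0 (L loglambda alpha a : C) : mu_const L loglambda alpha a <> 0.
Proof.
  unfold mu_const. apply Copp_neq_0.
  apply Cmult_neq_0; [apply Cmult_neq_0; [apply Cmult_neq_0|]|].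
  - apply Cmod_gt_0. rewrite Cmod_Ci. lra.
  - apply Cexp_neq_0.
  - apply Cexp_neq_0.
  - apply Cinv_neq_0, Cexp_neq_0.
Qed.

Definition mu_sol (L loglambda alpha a : C) (u : C) : C :=
  Cexp ((a - RtoC 1 / RtoC 2) * u) *
  mu L (u + loglambda + alpha * L) (loglambda + a * L).

(** The factor [x^(1/2)] of the square root in [mu] turns [x^(a - 1/2)] into [x^a], so all
    dependence on [u] sits in [e^(a u)] and in the Appell series. *)
Lemma mu_sol_appell (L loglambda alpha a u : C) :
  mu_sol L loglambda alpha a u =
  Ci * Cexp (- (L / RtoC 8)) * Cexp ((loglambda + loglambda + alpha * L + a * L) / RtoC 2)
  / theta (Cexp L) (- Cexp (loglambda + a * L)) * Cexp (a * u)
  * appell (Cexp L) (Cexp u * Cexp (loglambda + alpha * L)) (Cexp (loglambda + a * L)).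
Proof.
  unfold mu_sol, mu. cbv zeta.
  change (CSeriesZ _) with
    (appell (Cexp L) (Cexp (u + loglambda + alpha * L)) (Cexp (loglambda + a * L))).
  replace (Cexp u * Cexp (loglambda + alpha * L)) with (Cexp (u + loglambda + alpha * L))
    by (rewrite <- Cexp_plus; f_equal; ring).
  replace (Cexp ((u + loglambda + alpha * L + (loglambda + a * L)) / RtoC 2))
    with (Cexp (u / RtoC 2)
          * Cexp ((loglambda + loglambda + alpha * L + a * L) / RtoC 2)).
  2:{ rewrite <- Cexp_plus. f_equal. field. }
  replace (Cexp (a * u))
    with (Cexp ((a - RtoC 1 / RtoC 2) * u) * Cexp (u / RtoC 2)).
  2:{ rewrite <- Cexp_plus. f_equal. field. }
  unfold Cdiv. ring.
Qed.

Lemma meromorphic_mu_sol (L loglambda alpha a : C) : (Cmod (Cexp L) < 1)%R ->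
  meromorphic (mu_sol L loglambda alpha a).
Proof.
  intros Hq1.
  eapply meromorphic_ext; [apply mero_eq_sym, mero_eq_ext, mu_sol_appell|].
  apply meromorphic_mult.
  - apply meromorphic_mult; [apply meromorphic_const|].
    apply meromorphic_entire. intros z. apply Cdiff_Cexp_mult.
  - apply meromorphic_appell; auto using Cexp_neq_0.
Qed.

Lemma mu_sol_first_order (L loglambda alpha a : C) : (Cmod (Cexp L) < 1)%R ->
  (forall n : Z, Cexp (loglambda + a * L) <> Cpowz (Cexp L) n) ->
  mero_eq (fun u => qshift L (mu_sol L loglambda alpha a) u
             + Cexp u * Cexp (alpha * L) * mu_sol L loglambda alpha a u)
    (fun u => mu_const L loglambda alpha a * Cexp (a * u)).
Proof.
  intros Hq1 Hy u0.
  assert (Hq : Cexp L <> 0) by apply Cexp_neq_0.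
  assert (Hp : Cexp (loglambda + alpha * L) <> 0) by apply Cexp_neq_0.
  assert (Hth : theta (Cexp L) (- Cexp (loglambda + a * L)) <> 0).
  { apply theta_neq_0; auto using Copp_neq_0, Cexp_neq_0.
    intros n. replace (- - Cexp (loglambda + a * L)) with (Cexp (loglambda + a * L)) by ring.
    apply Hy. }
  generalize (locally'_one_minus_qpow (Cexp L) _ u0 Hq Hq1 Hp).
  apply filter_imp. intros u Hu. unfold qshift. rewrite !mu_sol_appell.
  replace (Cexp (u + L) * Cexp (loglambda + alpha * L))
    with (Cexp u * Cexp (loglambda + alpha * L) * Cexp L) by (rewrite (Cexp_plus u L); ring).
  rewrite appell_shift; auto using Cexp_neq_0, Cmult_neq_0.
  unfold mu_const. rewrite Cexp_mult_shift.
  set (A := appell _ _ _). set (T := theta _ _) in *.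
  rewrite !(Cexp_plus loglambda).
  pose proof (Cexp_neq_0 loglambda). pose proof (Cexp_neq_0 (a * L)).
  field. auto.
Qed.

(** [ha] separates the parameters through the eigenvalues [q^(a j)]. If [q^(a j) = q^(a k)], then
    [x^(a j - a k)] is q-periodic and, by [mu_sol_appell], the two solutions are proportional over
    the periodic functions; distinct exponents alone do not prevent this, since [Cexp] is
    periodic. *)
Theorem theorem1
  (q logq : C) (hq : q <> RtoC 0) (hq1 : (Cmod q < 1)%R) (hlogq : Cexp logq = q)
  (lambda loglambda : C) (hlambda : lambda <> RtoC 0)
  (hloglambda : Cexp loglambda = lambda)
  (m : nat) (hm : (2 <= m)%nat) (alpha : C) (a : nat -> C)
  (ha : forall j k, (1 <= j < m)%nat -> (1 <= k < m)%nat -> j <> k ->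
          Cexp (a j * logq) <> Cexp (a k * logq))
  (hmu : forall j, (1 <= j < m)%nat ->
          forall n : Z, lambda * Cexp (a j * logq) <> Cpowz q n) :
  fundamental_solutions logq m
    (qdiff_op logq alpha a m) (qsol logq loglambda alpha a).
Proof.
  subst q lambda.
  destruct m as [|n]; [lia|].
  assert (hp : Cexp (alpha * logq) <> 0) by apply Cexp_neq_0.
  (* The inverse of the solution of index 0 is theta itself, which is entire in [u]. *)
  apply (fundamental_solutions_factored logq alpha a n _
    (fun u => theta (Cexp logq) (- (Cexp u * Cexp (alpha * logq))))
    (fun j => mu_const logq loglambda alpha (a j))).
  - intros j k Hj Hk. apply ha; lia.
  - apply meromorphic_entire. intros u. now apply Cdiff_theta_Cexp.
  - intros [|j] Hj.
    + intros u0. apply (finite_order_at_inv (fun u => theta _ _)).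
      * unfold holomorphic_near. apply filter_forall. intros u. now apply Cdiff_theta_Cexp.
      * now apply finite_order_at_theta.
    + now apply (meromorphic_mu_sol logq loglambda alpha (a (S j))).
  - intros u0. generalize (finite_order_at_neq_0 _ _
      (finite_order_at_theta _ _ u0 hq hq1 hp)).
    apply filter_imp. intros u Hu. simpl. field. exact Hu.
  - now apply inv_theta_first_order.
  - intros [|j] Hj; [lia|]. split; [apply mu_const_neq_0|].
    apply (mu_sol_first_order logq loglambda alpha (a (S j))); [easy|].
    intros k. rewrite Cexp_plus. apply hmu. lia.
Qed.
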